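(* Let $G$ be a group, let $R$ be a $G$-graded ring, let $M$ be a graded right $R$-module and let $S=\mathrm{END}_R(M)$. (1) Assume that $M$ is a flat graded left $S$-module. (i) If $M$ is a self-CS-Rickart graded right $R$-module, then $S$ is a self-CS-Rickart graded right $S$-module. (ii) If $M$ is a faithfully projective graded right $R$-module and $S$ is a self-CS-Rickart graded right $S$-module, then $M$ is a self-CS-Rickart graded right $R$-module. (2) Assume that $M$ is a projective graded right $R$-module. (i) If $S$ is a dual self-CS-Rickart graded right $S$-module, then $M$ is a dual self-CS-Rickart graded right $R$-module. (ii) If $M$ is a faithfully flat graded left $S$-module and $M$ is a dual self-CS-Rickart graded right $R$-module, then $S$ is a dual self-CS-Rickart graded right $S$-module. (3) Assume that $M$ is an injective graded left $S$-module. (i) If $M$ is a dual self-CS-Rickart graded right $R$-module, then $S$ is a self-CS-Rickart graded left $S$-module. (ii) If $M$ is a faithfully injective graded right $R$-module and $S$ is a self-CS-Rickart graded left $S$-module, then $M$ is a dual self-CS-Rickart graded right $R$-module.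
   Context: In an abelian category: a morphism $s:A\to B$ is a section (resp. $r:A\to B$ is a retraction) if there is $s':B\to A$ with $s's=1_A$ (resp. $r':B\to A$ with $rr'=1_B$). A monomorphism $f:X\to Y$ is essential if for every morphism $h:Y\to P$ such that $hf$ is a monomorphism, $h$ is a monomorphism. An epimorphism $f:X\to Y$ is superfluous if for every morphism $h:P\to X$ such that $fh$ is an epimorphism, $h$ is an epimorphism. An object $N$ of an abelian category is self-CS-Rickart if for every endomorphism $f:N\to N$ there are an essential monomorphism $u:\mathrm{Ker}(f)\to L$ and a section $s:L\to N$ with $\ker(f)=su$; it is dual self-CS-Rickart if for every endomorphism $f:N\to N$ there are a retraction $r:N\to P$ and a superfluous epimorphism $t:P\to \mathrm{Coker}(f)$ with $\mathrm{coker}(f)=tr$. $\mathrm{gr}(R)$ is the category of $G$-graded unital right $R$-modules with degree-preserving homomorphisms; $\mathrm{gr}(S)$ is defined likewise, and $\mathrm{gr}(S^{\mathrm{op}})$ denotes the category of $G$-graded left $S$-modules. All notions for graded modules (self-CS-Rickart, dual self-CS-Rickart, projective, injective) are taken in these categories. For graded right $R$-modules $X,Y$, $\mathrm{HOM}_R(X,Y)=\bigoplus_{\sigma\in G}\mathrm{HOM}_R(X,Y)_\sigma$, where $\mathrm{HOM}_R(X,Y)_\sigma=\{f\in\mathrm{Hom}_R(X,Y)\mid f(X_\lambda)\subseteq Y_{\sigma\lambda}\text{ for all }\lambda\in G\}$. Then $S=\mathrm{END}_R(M)=\mathrm{HOM}_R(M,M)$ is a $G$-graded ring under composition and $M$ is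 a graded $(S,R)$-bimodule: $S_\tau M_\sigma R_\lambda\subseteq M_{\tau\sigma\lambda}$. For a graded right $S$-module $N$, $N\otimes_S M$ is a graded right $R$-module with $(N\otimes_S M)_\tau=\{\sum_{\sigma\lambda=\tau}n_\sigma\otimes m_\lambda\mid n_\sigma\in N_\sigma,\ m_\lambda\in M_\lambda\}$. The graded left $S$-module $M$ is flat if $-\otimes_S M:\mathrm{gr}(S)\to\mathrm{gr}(R)$ is exact. A covariant functor $F$ between abelian categories is faithfully exact if $F(A)\to F(B)\to F(C)$ is exact if and only if $A\to B\to C$ is exact; for contravariant $F$ the condition is that $F(C)\to F(B)\to F(A)$ is exact if and only if $A\to B\to C$ is exact. The graded right $R$-module $M$ is faithfully projective if $\mathrm{HOM}_R(M,-):\mathrm{gr}(R)\to\mathrm{gr}(S)$ is faithfully exact, and faithfully injective if $\mathrm{HOM}_R(-,M):\mathrm{gr}(R)\to \mathrm{gr}(S^{\mathrm{op}})$ is faithfully exact; the graded left $S$-module $M$ is faithfully flat if $-\otimes_S M:\mathrm{gr}(S)\to\mathrm{gr}(R)$ is faithfully exact. *)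

(* Defs.v *)
From HB Require Import structures.
From mathcomp Require Import all_boot all_algebra.
From mathcomp Require Import boolp classical_sets.

Set Implicit Arguments.
Unset Strict Implicit.
Unset Printing Implicit Defensive.

Import GRing.Theory.
Local Open Scope classical_set_scope.
Local Open Scope ring_scope.

(* The notions below are those of abelian categories, but their definitions   *)
(* only involve the composition and the zero morphisms.                       *)
Record zcat := ZCat {
  ob :> Type;
  hom : ob -> ob -> Type;
  idm : forall A, hom A A;
  compm : forall A B C, hom B C -> hom A B -> hom A C;
  zerom : forall A B, hom A B;
  _ : forall A B (f : hom A B), compm (idm B) f = f;
  _ : forall A B (f : hom A B), compm f (idm A) = f;
  _ : forall A B C D (h : hom C D) (g : hom B C) (f : hom A B),
        compm h (compm g f) = compm (compm h g) f;
  _ : forall A B C (f : hom A B), compm (zerom B C) f = zerom A C;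
  _ : forall A B C (g : hom B C), compm g (zerom A B) = zerom A C }.

Arguments hom {z}.
Arguments idm {z}.
Arguments compm {z A B C}.
Arguments zerom {z}.

Notation "g \oc f" := (compm g f) (at level 50, left associativity).

Section CategoricalNotions.
Variable C : zcat.

Definition is_mono (A B : C) (f : hom A B) :=
  forall (T : C) (g h : hom T A), f \oc g = f \oc h -> g = h.

Definition is_epi (A B : C) (f : hom A B) :=
  forall (T : C) (g h : hom B T), g \oc f = h \oc f -> g = h.

Definition is_section (A B : C) (s : hom A B) :=
  exists s' : hom B A, s' \oc s = idm A.

Definition is_retraction (A B : C) (r : hom A B) :=
  exists r' : hom B A, r \oc r' = idm B.

Definition essential_mono (X Y : C) (f : hom X Y) :=
  is_mono f /\
  forall (P : C) (h : hom Y P), is_mono (h \oc f) -> is_mono h.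

Definition superfluous_epi (X Y : C) (f : hom X Y) :=
  is_epi f /\
  forall (P : C) (h : hom P X), is_epi (f \oc h) -> is_epi h.

Definition is_kernel (A B K : C) (f : hom A B) (k : hom K A) :=
  f \oc k = zerom K B /\
  forall (T : C) (t : hom T A), f \oc t = zerom T B ->
    exists! u : hom T K, k \oc u = t.

Definition is_cokernel (A B Q : C) (f : hom A B) (c : hom B Q) :=
  c \oc f = zerom A Q /\
  forall (T : C) (t : hom B T), t \oc f = zerom A T ->
    exists! u : hom Q T, u \oc c = t.

Definition self_CS_Rickart (N : C) :=
  forall f : hom N N, exists (K : C) (k : hom K N), is_kernel f k /\
    exists (L : C) (u : hom K L) (s : hom L N),
      [/\ essential_mono u, is_section s & k = s \oc u].

Definition dual_self_CS_Rickart (N : C) :=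
  forall f : hom N N, exists (Q : C) (c : hom N Q), is_cokernel f c /\
    exists (P : C) (r : hom N P) (t : hom P Q),
      [/\ is_retraction r, superfluous_epi t & c = t \oc r].

Definition projective_object (P : C) :=
  forall (A B : C) (g : hom A B) (f : hom P B), is_epi g ->
    exists f' : hom P A, g \oc f' = f.

Definition injective_object (E : C) :=
  forall (A B : C) (g : hom A B) (f : hom A E), is_mono g ->
    exists f' : hom B E, f' \oc g = f.

(* [i] is the image of [f], that is, the kernel of its cokernel, and it is    *)
(* also the kernel of [g].                                                    *)
Definition exact_at (A B D : C) (f : hom A B) (g : hom B D) :=
  exists (Q I : C) (c : hom B Q) (i : hom I B),
    [/\ is_cokernel f c, is_kernel c i & is_kernel g i].

End CategoricalNotions.

Record functor (C D : zcat) := Functor {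
  fob :> C -> D;
  fmap : forall A B : C, hom A B -> hom (fob A) (fob B);
  _ : forall A, fmap (idm A) = idm (fob A);
  _ : forall A B E (g : hom B E) (f : hom A B),
        fmap (g \oc f) = fmap g \oc fmap f }.

Record cofunctor (C D : zcat) := Cofunctor {
  cfob :> C -> D;
  cfmap : forall A B : C, hom A B -> hom (cfob B) (cfob A);
  _ : forall A, cfmap (idm A) = idm (cfob A);
  _ : forall A B E (g : hom B E) (f : hom A B),
        cfmap (g \oc f) = cfmap f \oc cfmap g }.

Definition exact_functor (C D : zcat) (F : functor C D) :=
  forall (X Y Z : C) (f : hom X Y) (g : hom Y Z),
    exact_at f g -> exact_at (fmap F f) (fmap F g).

Definition faithfully_exact (C D : zcat) (F : functor C D) :=
  forall (X Y Z : C) (f : hom X Y) (g : hom Y Z),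
    exact_at (fmap F f) (fmap F g) <-> exact_at f g.

Definition faithfully_exact_contra (C D : zcat) (F : cofunctor C D) :=
  forall (X Y Z : C) (f : hom X Y) (g : hom Y Z),
    exact_at (cfmap F g) (cfmap F f) <-> exact_at f g.

(* [gr] is an internal direct sum decomposition of [V] into subgroups.        *)
Record is_grading (I : choiceType) (V : zmodType) (gr : I -> set V) : Prop :=
  IsGrading {
  gr0 : forall i, gr i 0;
  grB : forall i x y, gr i x -> gr i y -> gr i (x - y);
  gr_span : forall v, exists (s : seq I) (F : I -> V),
    [/\ uniq s, forall i, gr i (F i) & v = \sum_(i <- s) F i];
  gr_direct : forall (s : seq I) (F : I -> V),
    uniq s -> (forall i, gr i (F i)) -> \sum_(i <- s) F i = 0 ->
    forall i, i \in s -> F i = 0 }.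

Record gradedRing (G : groupType) := GradedRing {
  gring :> pzRingType;
  rgr : G -> set gring;
  rgrP : is_grading rgr;
  rgrM : forall (a b : G) (x y : gring),
    rgr a x -> rgr b y -> rgr (a * b)%g (x * y) }.

(* Graded right and left modules are treated uniformly: [act a b] is the      *)
(* degree of the product of a scalar of degree [a] by a vector of degree [b]. *)
Record gmod (G : groupType) (K : pzRingType) (kgr : G -> set K)
    (act : G -> G -> G) := GMod {
  gmod_sort :> lmodType K;
  mgr : G -> set gmod_sort;
  mgrP : is_grading mgr;
  mgrZ : forall (a b : G) (k : K) (x : gmod_sort),
    kgr a k -> mgr b x -> mgr (act a b) (k *: x) }.

Section GradedCategory.
Variables (G : groupType) (K : pzRingType) (kgr : G -> set K).
Variable act : G -> G -> G.
Implicit Types X Y Z : gmod kgr act.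

Record ghom X Y := GHom {
  ghom_fun :> X -> Y;
  ghom_linear : linear ghom_fun;
  ghom_deg : forall a x, mgr a x -> mgr a (ghom_fun x) }.

Lemma ghomP X Y (f g : ghom X Y) : f =1 g -> f = g.
Proof.
case: f g => [f lf df] [g lg dg] /= /funext fg; subst g.
by rewrite (Prop_irrelevance lf lg) (Prop_irrelevance df dg).
Qed.

Definition ghom_id X : ghom X X :=
  @GHom X X id (fun _ _ _ => erefl) (fun _ _ h => h).

Lemma ghom_comp_linear X Y Z (g : ghom Y Z) (f : ghom X Y) : linear (g \o f).
Proof. by move=> a x y /=; rewrite !ghom_linear. Qed.

Definition ghom_comp X Y Z (g : ghom Y Z) (f : ghom X Y) : ghom X Z :=
  GHom (ghom_comp_linear g f)
    (fun a x h => ghom_deg g (ghom_deg f h)).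

Lemma zero_linear X Y : linear (fun _ : X => 0 : Y).
Proof. by move=> a x y; rewrite scaler0 addr0. Qed.

Definition ghom_zero X Y : ghom X Y :=
  GHom (@zero_linear X Y) (fun a _ _ => gr0 (mgrP Y) a).

Lemma ghom0 X Y (f : ghom X Y) : f 0 = 0.
Proof.
have := ghom_linear f 1 0 0; rewrite !scale1r addr0 => h.
by apply: (addrI (f 0)); rewrite -h addr0.
Qed.

Definition gcat : zcat.
Proof.
refine (@ZCat (gmod kgr act) ghom ghom_id ghom_comp ghom_zero _ _ _ _ _).
- by move=> A B f; apply: ghomP.
- by move=> A B f; apply: ghomP.
- by move=> *; apply: ghomP.
- by move=> *; apply: ghomP.
- by move=> A B C g; apply: ghomP => x; apply: ghom0.
Defined.

End GradedCategory.

(* Right modules over R are modules over the converse ring R^c.               *)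
Notation grRight R := (@gmod _ (R^c) (@rgr _ R) (fun a b => (b * a)%g)).
Notation grLeft R := (@gmod _ R (@rgr _ R) (fun a b => (a * b)%g)).

Definition gr (G : groupType) (R : gradedRing G) : zcat :=
  @gcat G (R^c) (@rgr G R) (fun a b => (b * a)%g).
Definition grop (G : groupType) (R : gradedRing G) : zcat :=
  @gcat G R (@rgr G R) (fun a b => (a * b)%g).

Lemma sum_extend (I : choiceType) (V : zmodType) (s t : seq I) (F : I -> V) :
  uniq s -> uniq t -> {subset s <= t} ->
  \sum_(i <- s) F i = \sum_(i <- t) (if i \in s then F i else 0).
Proof.
move=> us ut st; rewrite -big_mkcond /= -[RHS]big_filter.
apply: perm_big; apply: uniq_perm => //; first exact: filter_uniq.
by move=> i; rewrite mem_filter; case: (boolP (i \in s)) => //= /st ->.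
Qed.

Section HomogeneousSums.
Variables (I : choiceType) (V : zmodType) (gr : I -> set V).
Hypothesis gr0' : forall i, gr i 0.
Hypothesis grB' : forall i x y, gr i x -> gr i y -> gr i (x - y).

Definition homog_sum (v : V) := exists (s : seq I) (F : I -> V),
  [/\ uniq s, forall i, gr i (F i) & v = \sum_(i <- s) F i].

Lemma homog_sumB x y : homog_sum x -> homog_sum y -> homog_sum (x - y).
Proof.
move=> [s [F [us hF ->]]] [t [H [ut hH ->]]].
exists (undup (s ++ t)).
exists (fun i => (if i \in s then F i else 0) - (if i \in t then H i else 0)).
split; first exact: undup_uniq.
  by move=> i; apply: grB'; case: ifP.
rewrite sumrB; congr (_ - _); apply: sum_extend => //; rewrite ?undup_uniq //.
  by move=> i; rewrite mem_undup mem_cat => ->.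
by move=> i; rewrite mem_undup mem_cat orbC => ->.
Qed.

Lemma homog_sum_hom i x : gr i x -> homog_sum x.
Proof.
move=> hx; exists [:: i], (fun j => if j == i then x else 0); split => //.
  by move=> j; case: eqP => // ->.
by rewrite big_seq1 eqxx.
Qed.

Lemma homog_sum0 (i : I) : homog_sum 0.
Proof. exact: (homog_sum_hom (i := i)). Qed.

End HomogeneousSums.

Section Hom.
Variables (G : groupType) (R : gradedRing G).
Implicit Types X Y Z M : grRight R.

Definition hom_deg X Y (a : G) (f : X -> Y) :=
  linear f /\ forall b x, mgr b x -> mgr (a * b)%g (f x).

(* The elements of HOM_R(X, Y): sums of finitely many R-linear maps, each of  *)
(* some degree.                                                               *)
Record HOM X Y := Hom {
  hfun :> X -> Y;
  hfunP : exists (s : seq G) (F : G -> X -> Y),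
    [/\ uniq s, forall a, hom_deg a (F a) &
        forall x, hfun x = \sum_(a <- s) F a x] }.

Lemma HOMP X Y (f g : HOM X Y) : f =1 g -> f = g.
Proof.
case: f g => [f hf] [g hg] /= /funext fg; subst g.
by rewrite (Prop_irrelevance hf hg).
Qed.

HB.instance Definition _ X Y := gen_eqMixin (HOM X Y).
HB.instance Definition _ X Y := gen_choiceMixin (HOM X Y).

Lemma HOM_linear X Y (f : HOM X Y) : linear f.
Proof.
case: (hfunP f) => s [F [_ hF fE]] r x y; rewrite !fE scaler_sumr -big_split /=.
by apply: eq_bigr => a _; rewrite (hF a).1.
Qed.

Lemma hom_deg0 X Y a : hom_deg a (fun _ : X => 0 : Y).
Proof.
split; first exact: zero_linear.
by move=> b x _; apply: gr0 (mgrP Y) _.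
Qed.

Lemma hom_degB X Y a (f g : X -> Y) :
  hom_deg a f -> hom_deg a g -> hom_deg a (fun x => f x - g x).
Proof.
move=> [lf df] [lg dg]; split.
  by move=> r x y; rewrite lf lg scalerBr opprD addrACA.
by move=> b x hx; apply: (grB (mgrP Y)); [apply: df|apply: dg].
Qed.

Lemma HOM0_subproof X Y : exists (s : seq G) (F : G -> X -> Y),
  [/\ uniq s, forall a, hom_deg a (F a) &
      forall x, 0 = \sum_(a <- s) F a x].
Proof.
exists [::], (fun _ _ => 0); split => // [a|x]; first exact: hom_deg0.
by rewrite big_nil.
Qed.

Definition HOM_zero X Y : HOM X Y := Hom (HOM0_subproof X Y).

Lemma HOMB_subproof X Y (f g : HOM X Y) : exists (s : seq G) (F : G -> X -> Y),
  [/\ uniq s, forall a, hom_deg a (F a) &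
      forall x, f x - g x = \sum_(a <- s) F a x].
Proof.
case: (hfunP f) (hfunP g) => s [F [us hF fE]] [t [H [ut hH gE]]].
exists (undup (s ++ t)), (fun i x => (if i \in s then F i x else 0)
   - (if i \in t then H i x else 0)).
split; first exact: undup_uniq.
  move=> a; apply: hom_degB; first by case: (a \in s) => //; apply: hom_deg0.
  by case: (a \in t) => //; apply: hom_deg0.
move=> x; rewrite fE gE sumrB.
congr (_ - _); apply: sum_extend => //; rewrite ?undup_uniq //.
  by move=> i; rewrite mem_undup mem_cat => ->.
by move=> i; rewrite mem_undup mem_cat orbC => ->.
Qed.

Definition HOM_sub X Y (f g : HOM X Y) : HOM X Y := Hom (HOMB_subproof f g).
Definition HOM_opp X Y (f : HOM X Y) : HOM X Y := HOM_sub (HOM_zero X Y) f.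
Definition HOM_add X Y (f g : HOM X Y) : HOM X Y := HOM_sub f (HOM_opp g).

Lemma HOM_oppE X Y (f : HOM X Y) x : HOM_opp f x = - f x.
Proof. by rewrite /= sub0r. Qed.

Lemma HOM_addE X Y (f g : HOM X Y) x : HOM_add f g x = f x + g x.
Proof. by rewrite /= sub0r opprK. Qed.

Lemma HOM_addA X Y : associative (@HOM_add X Y).
Proof. by move=> f g h; apply: HOMP => x; rewrite !HOM_addE addrA. Qed.

Lemma HOM_addC X Y : commutative (@HOM_add X Y).
Proof. by move=> f g; apply: HOMP => x; rewrite !HOM_addE addrC. Qed.

Lemma HOM_add0 X Y : left_id (HOM_zero X Y) (@HOM_add X Y).
Proof. by move=> f; apply: HOMP => x; rewrite HOM_addE add0r. Qed.

Lemma HOM_addN X Y : left_inverse (HOM_zero X Y) (@HOM_opp X Y) (@HOM_add X Y).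
Proof. by move=> f; apply: HOMP => x; rewrite HOM_addE HOM_oppE addNr. Qed.

HB.instance Definition _ X Y := GRing.isZmodule.Build (HOM X Y)
  (@HOM_addA X Y) (@HOM_addC X Y) (@HOM_add0 X Y) (@HOM_addN X Y).

Lemma hom0E X Y x : (0 : HOM X Y) x = 0. Proof. by []. Qed.
Lemma homDE X Y (f g : HOM X Y) x : (f + g) x = f x + g x.
Proof. exact: HOM_addE. Qed.
Lemma homNE X Y (f : HOM X Y) x : (- f) x = - f x.
Proof. exact: HOM_oppE. Qed.
Lemma homBE X Y (f g : HOM X Y) x : (f - g) x = f x - g x.
Proof. by rewrite homDE homNE. Qed.
Lemma hom_sumE X Y (J : Type) (s : seq J) (F : J -> HOM X Y) x :
  (\sum_(j <- s) F j) x = \sum_(j <- s) F j x.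
Proof.
by elim: s => [|j s IHs]; rewrite ?big_nil ?hom0E // !big_cons homDE IHs.
Qed.

Lemma homD X Y (f : HOM X Y) x y : f (x + y) = f x + f y.
Proof. by have := HOM_linear f 1 x y; rewrite !scale1r. Qed.
Lemma homZ X Y (f : HOM X Y) r x : f (r *: x) = r *: f x.
Proof.
have f0 : f 0 = 0 by apply: (addrI (f 0)); rewrite -(homD f 0 0) !addr0.
by have := HOM_linear f r x 0; rewrite f0 !addr0.
Qed.
Lemma hom0 X Y (f : HOM X Y) : f 0 = 0.
Proof. by have := homZ f 0 0; rewrite !scale0r. Qed.
Lemma homN X Y (f : HOM X Y) x : f (- x) = - f x.
Proof. by rewrite -!scaleN1r homZ. Qed.
Lemma homB X Y (f : HOM X Y) x y : f (x - y) = f x - f y.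
Proof. by rewrite homD homN. Qed.
Lemma hom_sum X Y (f : HOM X Y) (J : Type) (s : seq J) (F : J -> X) :
  f (\sum_(j <- s) F j) = \sum_(j <- s) f (F j).
Proof.
by elim: s => [|j s IHs]; rewrite ?big_nil ?hom0 // !big_cons homD IHs.
Qed.

Definition HOMgr X Y (a : G) : set (HOM X Y) :=
  [set f | forall b x, mgr b x -> mgr (a * b)%g (f x)].

Lemma hom_deg_HOM X Y a (f : X -> Y) : hom_deg a f ->
  exists2 g : HOM X Y, HOMgr a g & g =1 f.
Proof.
move=> hf.
have H : exists (s : seq G) (F : G -> X -> Y),
  [/\ uniq s, forall b, hom_deg b (F b) &
      forall x, f x = \sum_(b <- s) F b x].
  exists [:: a], (fun b => if b == a then f else fun=> 0); split => // [b|x].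
    by case: eqP => [->|_] //; apply: hom_deg0.
  by rewrite big_seq1 eqxx.
by exists (Hom H) => //; case: hf.
Qed.

Lemma HOMgr_direct X Y : forall (s : seq G) (F : G -> HOM X Y),
  uniq s -> (forall a, HOMgr a (F a)) -> \sum_(a <- s) F a = 0 ->
  forall a, a \in s -> F a = 0.
Proof.
move=> s F us hF F0 a sa; apply: HOMP => x; rewrite hom0E.
have [t [x_ [ut hx ->]]] := gr_span (mgrP X) x.
rewrite hom_sum; apply: big1_seq => b /= _ {t ut}.
have /= := gr_direct (mgrP Y) (s := [seq c * b | c <- s]%g)
  (F := fun d => F (d * b^-1)%g (x_ b)) _ _ _ (i := (a * b)%g).
rewrite mulgK; apply.
- by rewrite map_inj_uniq //; apply: mulIg.
- by move=> d; rewrite -{1}[d](mulgVK b); apply: hF.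
- rewrite big_map -[RHS](@hom0E X Y (x_ b)) -F0 hom_sumE.
  by apply: eq_bigr => c _; rewrite mulgK.
- exact: map_f.
Qed.

Lemma HOMgrP X Y : is_grading (@HOMgr X Y).
Proof.
split.
- by move=> a b x _; apply: gr0 (mgrP Y) _.
- move=> a f g hf hg b x hx; rewrite homBE.
  by apply: (grB (mgrP Y)); [apply: hf|apply: hg].
- move=> f; case: (hfunP f) => s [F [us hF fE]].
  have /choice[H hH] : forall a, exists g : HOM X Y, HOMgr a g /\ g =1 F a.
    by move=> a; have [g] := hom_deg_HOM (hF a); exists g.
  exists s, H; split => // [a|]; first exact: (hH a).1.
  apply: HOMP => x; rewrite hom_sumE fE.
  by apply: eq_bigr => a _; rewrite (hH a).2.
- exact: HOMgr_direct.
Qed.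

Lemma HOM_comp_subproof X Y Z (g : HOM Y Z) (f : HOM X Y) :
  exists (s : seq G) (F : G -> X -> Z),
  [/\ uniq s, forall a, hom_deg a (F a) &
      forall x, g (f x) = \sum_(a <- s) F a x].
Proof.
suff [h hE] : exists h : HOM X Z, h =1 g \o f.
  by case: (hfunP h) => s [F [us hF E]]; exists s, F; split=> // x; rewrite -E hE.
have [s [F [_ hF ->]]] := gr_span (HOMgrP Y Z) g.
have [t [H [_ hH ->]]] := gr_span (HOMgrP X Y) f.
have /choice[C hC] : forall ab : G * G, exists h : HOM X Z, h =1 F ab.1 \o H ab.2.
  move=> [a b] /=; suff /hom_deg_HOM[h _ hE] : hom_deg (a * b)%g (F a \o H b).
    by exists h.
  split; first by move=> r x y /=; rewrite !HOM_linear.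
  by move=> c x hx /=; rewrite -mulgA; apply: hF; apply: hH.
exists (\sum_(a <- s) \sum_(b <- t) C (a, b)) => x /=.
rewrite !hom_sumE; apply: eq_bigr => a _; rewrite !hom_sumE hom_sum.
by apply: eq_bigr => b _; rewrite hC.
Qed.

Definition HOM_comp X Y Z (g : HOM Y Z) (f : HOM X Y) : HOM X Z :=
  Hom (HOM_comp_subproof g f).

Lemma HOM_compDl X Y Z (f g : HOM Y Z) (h : HOM X Y) :
  HOM_comp (f + g) h = HOM_comp f h + HOM_comp g h.
Proof. by apply: HOMP => x; rewrite [RHS]homDE; apply: homDE. Qed.
Lemma HOM_compDr X Y Z (f : HOM Y Z) (g h : HOM X Y) :
  HOM_comp f (g + h) = HOM_comp f g + HOM_comp f h.
Proof.
apply: HOMP => x; rewrite [RHS]homDE -[RHS](homD f (g x) (h x)).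
exact: congr1 (homDE g h x).
Qed.

Lemma HOM_id_subproof X : exists (s : seq G) (F : G -> X -> X),
  [/\ uniq s, forall a, hom_deg a (F a) & forall x, x = \sum_(a <- s) F a x].
Proof.
have /hom_deg_HOM[g _ gE] : hom_deg 1%g (@id X).
  by split=> // b x; rewrite mul1g.
case: (hfunP g) => s [F [us hF E]]; exists s, F.
by split => // x; rewrite -E gE.
Qed.

Definition HOM_id X : HOM X X := Hom (HOM_id_subproof X).

Lemma HOM_of_subproof X Y (f : ghom X Y) : exists (s : seq G) (F : G -> X -> Y),
  [/\ uniq s, forall a, hom_deg a (F a) & forall x, f x = \sum_(a <- s) F a x].
Proof.
have /hom_deg_HOM[g _ gE] : hom_deg 1%g f.
  by split=> [|b x]; [apply: ghom_linear|rewrite mul1g; apply: ghom_deg].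
case: (hfunP g) => s [F [us hF E]]; exists s, F.
by split => // x; rewrite -E gE.
Qed.

Definition HOM_of X Y (f : ghom X Y) : HOM X Y := Hom (HOM_of_subproof f).

Lemma HOMgr_of X Y (f : ghom X Y) : HOMgr 1%g (HOM_of f).
Proof. by move=> b x; rewrite mul1g /=; apply: ghom_deg. Qed.

Lemma HOMgr_comp X Y Z a b (g : HOM Y Z) (f : HOM X Y) :
  HOMgr a g -> HOMgr b f -> HOMgr (a * b)%g (HOM_comp g f).
Proof.
by move=> hg hf c x hx; rewrite -mulgA; apply: (hg _ _ (hf _ _ hx)).
Qed.

End Hom.

Section End.
Variables (G : groupType) (R : gradedRing G) (M : grRight R).

Definition END_type := HOM M M.
HB.instance Definition _ := GRing.Zmodule.on END_type.

Lemma END_mulA : associative (@HOM_comp _ _ M M M : END_type -> _ -> _).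
Proof. by move=> f g h; apply: HOMP. Qed.
Lemma END_mul1 : left_id (HOM_id M) (@HOM_comp _ _ M M M : END_type -> _ -> _).
Proof. by move=> f; apply: HOMP. Qed.
Lemma END_mulr1 : right_id (HOM_id M) (@HOM_comp _ _ M M M : END_type -> _ -> _).
Proof. by move=> f; apply: HOMP. Qed.
Lemma END_mulDl :
  left_distributive (@HOM_comp _ _ M M M : END_type -> _ -> _) +%R.
Proof. by move=> f g h; apply: HOM_compDl. Qed.
Lemma END_mulDr :
  right_distributive (@HOM_comp _ _ M M M : END_type -> _ -> _) +%R.
Proof. by move=> f g h; apply: HOM_compDr. Qed.

HB.instance Definition _ := GRing.Zmodule_isPzRing.Build END_type
  END_mulA END_mul1 END_mulr1 END_mulDl END_mulDr.

Definition END : gradedRing G :=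
  @GradedRing G END_type (@HOMgr _ _ M M) (HOMgrP M M)
    (fun a b f g => @HOMgr_comp _ _ M M M a b f g).

End End.

Section RegularModules.
Variables (G : groupType) (S : gradedRing G).

Definition regR : grRight S :=
  @GMod G (S^c) (@rgr _ S) _ ((S^c)^o) (@rgr _ S) (rgrP S)
    (fun a b k x hk hx => rgrM hx hk).

Definition regL : grLeft S :=
  @GMod G S (@rgr _ S) _ (S^o) (@rgr _ S) (rgrP S)
    (fun a b k x hk hx => rgrM hk hx).

End RegularModules.

Section HomFunctors.
Variables (G : groupType) (R : gradedRing G) (M : grRight R).
Implicit Types X Y Z : grRight R.

Definition HOMr Y := HOM M Y.
HB.instance Definition _ Y := GRing.Zmodule.on (HOMr Y).
Definition HOMr_act Y (s : (END M)^c) (f : HOMr Y) : HOMr Y := HOM_comp f s.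

Lemma HOMr_actA Y (s t : (END M)^c) (f : HOMr Y) :
  HOMr_act s (HOMr_act t f) = HOMr_act (s * t) f.
Proof. exact: HOMP. Qed.
Lemma HOMr_act1 Y : left_id 1 (@HOMr_act Y).
Proof. by move=> f; apply: HOMP. Qed.
Lemma HOMr_actDr Y : right_distributive (@HOMr_act Y) +%R.
Proof. by move=> s f g; apply: HOM_compDl. Qed.
Lemma HOMr_actDl Y (f : HOMr Y) :
  {morph (@HOMr_act Y)^~ f : s t / s + t >-> s + t}.
Proof. by move=> s t; apply: HOM_compDr. Qed.

HB.instance Definition _ Y := GRing.Zmodule_isLmodule.Build ((END M)^c) (HOMr Y)
  (@HOMr_actA Y) (@HOMr_act1 Y) (@HOMr_actDr Y) (@HOMr_actDl Y).

Definition HOMr_gmod Y : grRight (END M) :=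
  @GMod G ((END M)^c) (@rgr _ (END M)) _ (HOMr Y) (@HOMgr _ _ M Y) (HOMgrP M Y)
    (fun a b s f hs hf => HOMgr_comp hf hs).

Lemma HOMr_map_linear Y Z (g : ghom Y Z) :
  linear (fun f : HOMr_gmod Y => HOM_comp (HOM_of g) f : HOMr_gmod Z).
Proof. move=> s f h; rewrite [LHS](HOM_compDr (HOM_of g)); congr (_ + _); exact: HOMP. Qed.

Lemma HOMr_map_deg Y Z (g : ghom Y Z) a (f : HOMr_gmod Y) :
  mgr a f -> mgr a (HOM_comp (HOM_of g) f : HOMr_gmod Z).
Proof. by move=> hf; have := HOMgr_comp (HOMgr_of g) hf; rewrite mul1g. Qed.

(* HOM_R(M, -) : gr(R) -> gr(S)                                               *)
Definition HOM_from : functor (gr R) (gr (END M)).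
Proof.
refine (@Functor (gr R) (gr (END M)) HOMr_gmod
  (fun Y Z g => GHom (HOMr_map_linear g) (@HOMr_map_deg Y Z g)) _ _).
- by move=> Y; apply: ghomP => f; apply: HOMP.
- by move=> Y Z T g f; apply: ghomP => h; apply: HOMP.
Defined.

Definition HOMl X := HOM X M.
HB.instance Definition _ X := GRing.Zmodule.on (HOMl X).
Definition HOMl_act X (s : END M) (f : HOMl X) : HOMl X := HOM_comp s f.

Lemma HOMl_actA X (s t : END M) (f : HOMl X) :
  HOMl_act s (HOMl_act t f) = HOMl_act (s * t) f.
Proof. exact: HOMP. Qed.
Lemma HOMl_act1 X : left_id 1 (@HOMl_act X).
Proof. by move=> f; apply: HOMP. Qed.
Lemma HOMl_actDr X : right_distributive (@HOMl_act X) +%R.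
Proof. by move=> s f g; apply: HOM_compDr. Qed.
Lemma HOMl_actDl X (f : HOMl X) :
  {morph (@HOMl_act X)^~ f : s t / s + t >-> s + t}.
Proof. by move=> s t; apply: HOM_compDl. Qed.

HB.instance Definition _ X := GRing.Zmodule_isLmodule.Build (END M) (HOMl X)
  (@HOMl_actA X) (@HOMl_act1 X) (@HOMl_actDr X) (@HOMl_actDl X).

Definition HOMl_gmod X : grLeft (END M) :=
  @GMod G (END M) (@rgr _ (END M)) _ (HOMl X) (@HOMgr _ _ X M) (HOMgrP X M)
    (fun a b s f hs hf => HOMgr_comp hs hf).

Lemma HOMl_map_linear X Y (g : ghom X Y) :
  linear (fun f : HOMl_gmod Y => HOM_comp f (HOM_of g) : HOMl_gmod X).
Proof. move=> s f h; rewrite [LHS](HOM_compDl _ _ (HOM_of g)); congr (_ + _); exact: HOMP. Qed.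

Lemma HOMl_map_deg X Y (g : ghom X Y) a (f : HOMl_gmod Y) :
  mgr a f -> mgr a (HOM_comp f (HOM_of g) : HOMl_gmod X).
Proof. by move=> hf; have := HOMgr_comp hf (HOMgr_of g); rewrite mulg1. Qed.

(* HOM_R(-, M) : gr(R) -> gr(S^op)                                            *)
Definition HOM_into : cofunctor (gr R) (grop (END M)).
Proof.
refine (@Cofunctor (gr R) (grop (END M)) HOMl_gmod
  (fun X Y g => GHom (HOMl_map_linear g) (@HOMl_map_deg X Y g)) _ _).
- by move=> Y; apply: ghomP => f; apply: HOMP.
- by move=> Y Z T g f; apply: ghomP => h; apply: HOMP.
Defined.

Definition Mleft_type : Type := M.
HB.instance Definition _ := GRing.Zmodule.on Mleft_type.
Definition Mleft_act (s : END M) (m : Mleft_type) : Mleft_type :=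
  (s : HOM M M) m.

Lemma Mleft_actA (s t : END M) m :
  Mleft_act s (Mleft_act t m) = Mleft_act (s * t) m.
Proof. by []. Qed.
Lemma Mleft_act1 : left_id 1 Mleft_act. Proof. by []. Qed.
Lemma Mleft_actDr : right_distributive Mleft_act +%R.
Proof. by move=> s x y; apply: homD. Qed.
Lemma Mleft_actDl m : {morph Mleft_act^~ m : s t / s + t >-> s + t}.
Proof. by move=> s t; apply: (homDE (s : HOM M M)). Qed.

HB.instance Definition _ := GRing.Zmodule_isLmodule.Build (END M) Mleft_type
  Mleft_actA Mleft_act1 Mleft_actDr Mleft_actDl.

Definition Mleft : grLeft (END M) :=
  @GMod G (END M) (@rgr _ (END M)) _ Mleft_type (@mgr _ _ _ _ M) (mgrP M)
    (fun a b s x hs hx => hs b x hx).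

End HomFunctors.

Section Components.
Variables (I : choiceType) (V : zmodType) (gr : I -> set V).
Hypothesis grP : is_grading gr.

Lemma gcomp_exists v : exists F : I -> V, exists s : seq I,
  [/\ uniq s, forall i, gr i (F i), forall i, i \notin s -> F i = 0 &
      v = \sum_(i <- s) F i].
Proof.
have [s [F [us hF ->]]] := gr_span grP v.
exists (fun i => if i \in s then F i else 0), s; split => //.
- by move=> i; case: ifP => // _; apply: gr0 grP _.
- by move=> i /negbTE ->.
- exact: sum_extend.
Qed.

Definition gcomp v : I -> V := projT1 (cid (gcomp_exists v)).

Lemma gcomp_suppP v : exists s : seq I,
  [/\ uniq s, forall i, gr i (gcomp v i), forall i, i \notin s -> gcomp v i = 0 &
      v = \sum_(i <- s) gcomp v i].
Proof. exact: projT2 (cid (gcomp_exists v)). Qed.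

Definition gsupp v : seq I := projT1 (cid (gcomp_suppP v)).

Lemma gsupp_uniq v : uniq (gsupp v).
Proof. by have [] := projT2 (cid (gcomp_suppP v)). Qed.
Lemma gcomp_gr v i : gr i (gcomp v i).
Proof. by have [] := projT2 (cid (gcomp_suppP v)). Qed.
Lemma gcomp_out v i : i \notin gsupp v -> gcomp v i = 0.
Proof. by have [_ _ /(_ i)] := projT2 (cid (gcomp_suppP v)). Qed.
Lemma gcomp_sum v : \sum_(i <- gsupp v) gcomp v i = v.
Proof. by have [] := projT2 (cid (gcomp_suppP v)). Qed.

Lemma sum_supp (W : zmodType) (s t : seq I) (F : I -> W) :
  uniq s -> uniq t -> {subset s <= t} -> (forall i, i \notin s -> F i = 0) ->
  \sum_(i <- s) F i = \sum_(i <- t) F i.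
Proof.
move=> us ut st F0; rewrite (sum_extend _ us ut st).
by apply: eq_bigr => i _; case: ifPn => // /F0.
Qed.

Lemma gcomp_uniq v (s : seq I) (F : I -> V) : uniq s ->
  (forall i, gr i (F i)) -> (forall i, i \notin s -> F i = 0) ->
  v = \sum_(i <- s) F i -> gcomp v =1 F.
Proof.
move=> us hF F0 vE i; apply/eqP; rewrite -subr_eq0; apply/eqP.
set t := undup (gsupp v ++ s).
have st : {subset s <= t} by move=> j; rewrite mem_undup mem_cat orbC => ->.
have vt : {subset gsupp v <= t} by move=> j; rewrite mem_undup mem_cat => ->.
case: (boolP (i \in t)) => [it|]; last first.
  rewrite mem_undup mem_cat negb_or => /andP[/gcomp_out -> /F0 ->].
  by rewrite subrr.
apply: (gr_direct grP (s := t) (F := fun j => gcomp v j - F j)) => //.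
- exact: undup_uniq.
- by move=> j; apply: (grB grP) => //; apply: gcomp_gr.
- rewrite sumrB -(sum_supp (gsupp_uniq v) (undup_uniq _) vt (@gcomp_out v)).
  by rewrite -(sum_supp us (undup_uniq _) st F0) gcomp_sum -vE subrr.
Qed.

Lemma gcompB u v i : gcomp (u - v) i = gcomp u i - gcomp v i.
Proof.
set t := undup (gsupp u ++ gsupp v).
have ut : {subset gsupp u <= t} by move=> j; rewrite mem_undup mem_cat => ->.
have vt : {subset gsupp v <= t}.
  by move=> j; rewrite mem_undup mem_cat orbC => ->.
apply: (gcomp_uniq (s := t) (F := fun j => gcomp u j - gcomp v j)).
- exact: undup_uniq.
- by move=> j; apply: (grB grP); apply: gcomp_gr.
- move=> j; rewrite mem_undup mem_cat negb_or.
  by move=> /andP[/gcomp_out -> /gcomp_out ->]; rewrite subrr.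
- rewrite sumrB -(sum_supp (gsupp_uniq u) (undup_uniq _) ut (@gcomp_out u)).
  rewrite -(sum_supp (gsupp_uniq v) (undup_uniq _) vt (@gcomp_out v)).
  by rewrite !gcomp_sum.
Qed.

Lemma gcomp0 i : gcomp 0 i = 0.
Proof. by have := gcompB 0 0 i; rewrite !subrr. Qed.

Lemma gcompD u v i : gcomp (u + v) i = gcomp u i + gcomp v i.
Proof.
have -> : u + v = u - (0 - v) by rewrite sub0r opprK.
by rewrite !gcompB gcomp0 sub0r opprK.
Qed.

Lemma gcomp_homog i v j : gr i v -> gcomp v j = if j == i then v else 0.
Proof.
move=> hv.
apply: (gcomp_uniq (s := [:: i]) (F := fun j => if j == i then v else 0)) => //.
- by move=> k; case: eqP => [->|_] //; apply: gr0 grP _.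
- by move=> k; rewrite inE => /negbTE ->.
- by rewrite big_seq1 eqxx.
Qed.

End Components.

Section Tensor.
Variables (G : groupType) (R : gradedRing G) (M : grRight R).
Local Notation S := (END M).
Implicit Types N : grRight S.

(* The tensor product of a right S-module N and M over S = END_R(M) is        *)
(* presented by generators and relations: the list [:: (n1, m1); ...; (nk, mk)]*)
(* stands for the sum of the ni (x) mi. The relation [tens_zero] makes the    *)
(* presented commutative monoid a group, - (n (x) m) being (- n) (x) m.       *)
Inductive tens_eq N : seq (N * M) -> seq (N * M) -> Prop :=
| tens_refl s : tens_eq s s
| tens_sym s t : tens_eq s t -> tens_eq t s
| tens_trans s t u : tens_eq s t -> tens_eq t u -> tens_eq s u
| tens_cat s s' t t' :
    tens_eq s s' -> tens_eq t t' -> tens_eq (s ++ t) (s' ++ t')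
| tens_comm s t : tens_eq (s ++ t) (t ++ s)
| tens_zero m : tens_eq [:: (0, m)] [::]
| tens_addl n n' m : tens_eq [:: (n + n', m)] [:: (n, m); (n', m)]
| tens_addr n m m' : tens_eq [:: (n, m + m')] [:: (n, m); (n, m')]
| tens_bal n (s : HOM M M) m :
    tens_eq [:: ((s : S^c) *: n, m)] [:: (n, s m)].

Definition tens_eqb N : rel (seq (N * M)) := fun s t => `[< tens_eq s t >].

Lemma tens_eqb_refl N : reflexive (@tens_eqb N).
Proof. by move=> s; apply/asboolP; apply: tens_refl. Qed.
Lemma tens_eqb_sym N : symmetric (@tens_eqb N).
Proof. by move=> s t; apply/asboolP/asboolP; apply: tens_sym. Qed.
Lemma tens_eqb_trans N : transitive (@tens_eqb N).
Proof.
by move=> t s u /asboolP st /asboolP tu; apply/asboolP; apply: tens_trans st tu.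
Qed.

Canonical tens_equiv N :=
  EquivRel (@tens_eqb N) (@tens_eqb_refl N) (@tens_eqb_sym N) (@tens_eqb_trans N).

Definition tensor N := {eq_quot (tens_equiv N)}%qT.
HB.instance Definition _ N := Choice.on (tensor N).
HB.instance Definition _ N := EqQuotient.on (tensor N).

Definition tpi N (s : seq (N * M)) : tensor N := \pi_(tensor N)%qT s.
Definition trepr N (t : tensor N) : seq (N * M) := repr t.

Lemma treprK N (t : tensor N) : tpi (trepr t) = t.
Proof. exact: reprK. Qed.

Lemma tpiP N (s t : seq (N * M)) : tpi s = tpi t <-> tens_eq s t.
Proof.
split; first by move/eqmodP/asboolP.
by move=> h; apply/eqmodP/asboolP.
Qed.

Lemma trepr_pi N (s : seq (N * M)) : tens_eq (trepr (tpi s)) s.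
Proof. by apply/tpiP; rewrite treprK. Qed.

Definition tens_zeroE N : tensor N := tpi [::].
Definition tens_add N (x y : tensor N) : tensor N := tpi (trepr x ++ trepr y).
Definition tens_map N N' (f : N -> N') (g : M -> M) (s : seq (N * M)) :=
  [seq (f p.1, g p.2) | p <- s].
Definition tens_opp N (x : tensor N) : tensor N :=
  tpi (tens_map (fun n => - n) id (trepr x)).

Lemma tens_add_pi N (s t : seq (N * M)) : tens_add (tpi s) (tpi t) = tpi (s ++ t).
Proof. by apply/tpiP; apply: tens_cat; apply: trepr_pi. Qed.

Lemma tens_map_eq N N' (f : N -> N') (g : M -> M) :
  (forall n n', f (n + n') = f n + f n') ->
  (forall m m', g (m + m') = g m + g m') ->
  (forall (s : HOM M M) n, f ((s : S^c) *: n) = (s : S^c) *: f n) ->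
  (forall (s : HOM M M) m, g (s m) = s (g m)) ->
  forall s t, tens_eq s t -> tens_eq (tens_map f g s) (tens_map f g t).
Proof.
move=> fD gD fZ gZ s t; elim => {s t}.
- by move=> s; apply: tens_refl.
- by move=> s t _; apply: tens_sym.
- by move=> s t u _ h1 _; apply: tens_trans h1.
- by move=> s s' t t' _ h _ h'; rewrite /tens_map !map_cat; apply: tens_cat.
- by move=> s t; rewrite /tens_map !map_cat; apply: tens_comm.
- move=> m /=; have -> : f 0 = 0 by apply: (addrI (f 0)); rewrite -fD !addr0.
  exact: tens_zero.
- by move=> n n' m /=; rewrite fD; apply: tens_addl.
- by move=> n m m' /=; rewrite gD; apply: tens_addr.
- by move=> n r m /=; rewrite fZ gZ; apply: tens_bal.
Qed.

Lemma tens_map_opp N (s t : seq (N * M)) :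
  tens_eq s t -> tens_eq (tens_map (fun n => - n) id s) (tens_map (fun n => - n) id t).
Proof. by apply: tens_map_eq => // *; rewrite ?opprD ?scalerN. Qed.

Lemma tens_addA N : associative (@tens_add N).
Proof.
by move=> x y z; rewrite -[x]treprK -[y]treprK -[z]treprK !tens_add_pi catA.
Qed.
Lemma tens_addC N : commutative (@tens_add N).
Proof. by move=> x y; apply/tpiP; apply: tens_comm. Qed.
Lemma tens_add0 N : left_id (tens_zeroE N) (@tens_add N).
Proof. by move=> x; rewrite -[x]treprK tens_add_pi. Qed.
Lemma tens_addN N : left_inverse (tens_zeroE N) (@tens_opp N) (@tens_add N).
Proof.
move=> x; rewrite -{2}[x]treprK tens_add_pi.
elim: (trepr x) => [//|[n m] s IHs].
have catE (u v : seq (N * M)) : tpi (u ++ v) = tens_add (tpi u) (tpi v).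
  by rewrite tens_add_pi.
rewrite /= -cat1s -[(n, m) :: s]cat1s !catE.
rewrite (tens_addA (tpi (map _ _))) [tens_add (tpi (map _ _)) _]tens_addC.
rewrite -(tens_addA (tpi [:: (n, m)])) -(catE _ s) IHs tens_addA.
rewrite [tens_add _ (tens_zeroE N)]tens_addC tens_add0 tens_add_pi.
apply/tpiP/tens_sym; apply: tens_trans (tens_sym (tens_zero N m)) _.
by rewrite -{1}(addNr n); apply: tens_addl.
Qed.

HB.instance Definition _ N := GRing.isZmodule.Build (tensor N)
  (@tens_addA N) (@tens_addC N) (@tens_add0 N) (@tens_addN N).

Definition tmk N (n : N) (m : M) : tensor N := tpi [:: (n, m)].

Lemma tpi_cat N (s t : seq (N * M)) : tpi (s ++ t) = tpi s + tpi t.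
Proof. exact: esym (tens_add_pi s t). Qed.

Lemma tpi_sum N (s : seq (N * M)) : tpi s = \sum_(p <- s) tmk p.1 p.2.
Proof.
elim: s => [|[n m] s IHs]; first by rewrite big_nil.
by rewrite big_cons -IHs -cat1s tpi_cat.
Qed.

Lemma tensorP N (t : tensor N) : exists s : seq (N * M),
  t = \sum_(p <- s) tmk p.1 p.2.
Proof. by exists (trepr t); rewrite -tpi_sum treprK. Qed.

Lemma tmkDl N (n n' : N) m : tmk (n + n') m = tmk n m + tmk n' m.
Proof. by rewrite -tpi_cat; apply/tpiP; apply: tens_addl. Qed.
Lemma tmkDr N (n : N) m m' : tmk n (m + m') = tmk n m + tmk n m'.
Proof. by rewrite -tpi_cat; apply/tpiP; apply: tens_addr. Qed.
Lemma tmk_bal N (n : N) (s : HOM M M) m : tmk ((s : S^c) *: n) m = tmk n (s m).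
Proof. by apply/tpiP; apply: tens_bal. Qed.
Lemma tmk0l N m : tmk (0 : N) m = 0.
Proof. by apply: (addrI (tmk (0 : N) m)); rewrite -tmkDl !addr0. Qed.
Lemma tmk0r N n : tmk (n : N) 0 = 0.
Proof. by apply: (addrI (tmk n 0)); rewrite -tmkDr !addr0. Qed.
Lemma tmkNl N (n : N) m : tmk (- n) m = - tmk n m.
Proof.
by apply: (addIr (tmk n m)); rewrite -(tmkDl (- n)) (addNr n) tmk0l addNr.
Qed.

Section Lift.
Variables (N : grRight S) (A : zmodType) (b : N -> M -> A).
Hypothesis bDl : forall n n' m, b (n + n') m = b n m + b n' m.
Hypothesis bDr : forall n m m', b n (m + m') = b n m + b n m'.
Hypothesis bbal : forall n (s : HOM M M) m, b ((s : S^c) *: n) m = b n (s m).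

Definition tlift (t : tensor N) : A := \sum_(p <- trepr t) b p.1 p.2.

Lemma tlift_eq (s t : seq (N * M)) : tens_eq s t ->
  \sum_(p <- s) b p.1 p.2 = \sum_(p <- t) b p.1 p.2.
Proof.
elim => {s t} //.
- by move=> s t u _ -> _ ->.
- by move=> s s' t t' _ h _ h'; rewrite !big_cat /= h h'.
- by move=> s t; rewrite !big_cat /= addrC.
- move=> m; rewrite big_seq1 big_nil /=.
  by apply: (addrI (b 0 m)); rewrite -bDl !addr0.
- by move=> n n' m; rewrite !big_cons !big_nil /= !addr0.
- by move=> n m m'; rewrite !big_cons !big_nil /= !addr0.
- by move=> n s m; rewrite !big_seq1 /= bbal.
Qed.

Lemma tlift_pi s : tlift (tpi s) = \sum_(p <- s) b p.1 p.2.
Proof. exact: tlift_eq (trepr_pi s). Qed.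

Lemma tlift_mk n m : tlift (tmk n m) = b n m.
Proof. by rewrite tlift_pi big_seq1. Qed.

Lemma tliftD t u : tlift (t + u) = tlift t + tlift u.
Proof. by rewrite -[t]treprK -[u]treprK -tpi_cat !tlift_pi big_cat. Qed.

Lemma tlift0 : tlift 0 = 0.
Proof. by apply: (addrI (tlift 0)); rewrite -tliftD !addr0. Qed.

Lemma tlift_sum (J : Type) (s : seq J) (F : J -> tensor N) :
  tlift (\sum_(j <- s) F j) = \sum_(j <- s) tlift (F j).
Proof.
by elim: s => [|j s IHs]; rewrite ?big_nil ?tlift0 // !big_cons tliftD IHs.
Qed.

End Lift.

Section TensorScale.
Variable N : grRight S.

Definition tscale (r : R^c) : tensor N -> tensor N :=
  tlift (fun n m => tmk n (r *: m)).

Lemma tscale_mk r n m : tscale r (tmk n m) = tmk n (r *: m).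
Proof.
by apply: tlift_mk => [? ? ?|? ? ?|? s ?];
  rewrite ?tmkDl ?scalerDr ?tmkDr // tmk_bal homZ.
Qed.

Lemma tscaleD r : {morph tscale r : t u / t + u >-> t + u}.
Proof.
by apply: tliftD => [? ? ?|? ? ?|? s ?];
  rewrite ?tmkDl ?scalerDr ?tmkDr // tmk_bal homZ.
Qed.

Lemma tscale_sum r (s : seq (N * M)) :
  tscale r (\sum_(p <- s) tmk p.1 p.2) = \sum_(p <- s) tmk p.1 (r *: p.2).
Proof.
rewrite (big_morph _ (tscaleD r) (_ : tscale r 0 = 0)).
  by apply: eq_bigr => p _; rewrite tscale_mk.
by apply: (addrI (tscale r 0)); rewrite -tscaleD !addr0.
Qed.

Lemma tscaleA (r r' : R^c) t : tscale r (tscale r' t) = tscale (r * r') t.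
Proof.
have [s ->] := tensorP t; rewrite tscale_sum.
rewrite -(big_map (fun p => (p.1, r' *: p.2)) xpredT (fun p => tmk p.1 p.2)).
rewrite !tscale_sum big_map.
by apply: eq_bigr => p _; rewrite scalerA.
Qed.

Lemma tscale1 : left_id 1 tscale.
Proof.
move=> t; have [s ->] := tensorP t; rewrite tscale_sum.
by apply: eq_bigr => p _; rewrite scale1r.
Qed.

Lemma tscaleDl t : {morph tscale^~ t : r r' / r + r' >-> r + r'}.
Proof.
move=> r r'; have [s ->] := tensorP t; rewrite !tscale_sum -big_split /=.
by apply: eq_bigr => p _; rewrite scalerDl tmkDr.
Qed.

HB.instance Definition _ := GRing.Zmodule_isLmodule.Build (R^c) (tensor N)
  tscaleA tscale1 tscaleD tscaleDl.

Lemma tensZ (r : R^c) n m : r *: tmk n m = tmk n (r *: m).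
Proof. exact: tscale_mk. Qed.

End TensorScale.

Section TensorGrading.
Variable N : grRight S.

Definition tensor_gr (c : G) : set (tensor N) :=
  [set t | exists2 s : seq (N * M),
     (forall p, p \in s -> exists a b,
        [/\ (a * b)%g = c, mgr a p.1 & mgr b p.2]) &
     t = \sum_(p <- s) tmk p.1 p.2].

Let cN := gcomp (mgrP N).
Let sN := gsupp (mgrP N).
Let cM := gcomp (mgrP M).
Let sM := gsupp (mgrP M).

Definition tproj_gen (c : G) (n : N) (m : M) : tensor N :=
  \sum_(a <- sN n) tmk (cN n a) (cM m (a^-1 * c)%g).

Lemma tproj_genE c n m (s : seq G) : uniq s -> {subset sN n <= s} ->
  tproj_gen c n m = \sum_(a <- s) tmk (cN n a) (cM m (a^-1 * c)%g).
Proof.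
move=> us ns; apply: sum_supp => //; first exact: gsupp_uniq.
by move=> a /gcomp_out; rewrite -/cN /cN => ->; rewrite tmk0l.
Qed.

Lemma tproj_genDr c n m m' :
  tproj_gen c n (m + m') = tproj_gen c n m + tproj_gen c n m'.
Proof.
rewrite -big_split /=; apply: eq_bigr => a _.
by rewrite /cM gcompD tmkDr.
Qed.

Lemma tproj_genDl c n n' m :
  tproj_gen c (n + n') m = tproj_gen c n m + tproj_gen c n' m.
Proof.
set s := undup (sN (n + n') ++ sN n ++ sN n').
have us : uniq s by apply: undup_uniq.
rewrite !(@tproj_genE _ _ _ s) //; first last.
- by move=> a; rewrite mem_undup !mem_cat => ->.
- by move=> a; rewrite mem_undup !mem_cat => ->; rewrite !orbT.
- by move=> a; rewrite mem_undup !mem_cat => ->; rewrite !orbT.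
rewrite -big_split /=; apply: eq_bigr => a _.
by rewrite /cN gcompD tmkDl.
Qed.

Lemma tproj_gen_homog a b c n m : mgr a n -> mgr b m ->
  tproj_gen c n m = if c == (a * b)%g then tmk n m else 0.
Proof.
move=> hn hm; have us : uniq (undup (a :: sN n)) by apply: undup_uniq.
rewrite (tproj_genE c m us); last first.
  by move=> d hd; rewrite mem_undup inE hd orbT.
have ia : a \in undup (a :: sN n) by rewrite mem_undup mem_head.
rewrite (bigD1_seq a ia us) /= big1 => [|d da]; last first.
  by rewrite /cN (gcomp_homog _ _ hn) (negbTE da) tmk0l.
rewrite addr0 /cN (gcomp_homog _ _ hn) eqxx /cM (gcomp_homog _ _ hm).
have -> : (a^-1 * c == b)%g = (c == a * b)%g.
  by apply/eqP/eqP => [<-|->]; rewrite ?mulVKg ?mulKg.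
by case: eqP; rewrite ?tmk0r.
Qed.

Lemma tproj_gen_suml c (J : Type) (s : seq J) (F : J -> N) m :
  tproj_gen c (\sum_(j <- s) F j) m = \sum_(j <- s) tproj_gen c (F j) m.
Proof.
elim: s => [|j s IHs]; last by rewrite !big_cons tproj_genDl IHs.
rewrite !big_nil; apply: (addrI (tproj_gen c 0 m)).
by rewrite -tproj_genDl !addr0.
Qed.

Lemma tproj_gen_sumr c (J : Type) (s : seq J) (F : J -> M) n :
  tproj_gen c n (\sum_(j <- s) F j) = \sum_(j <- s) tproj_gen c n (F j).
Proof.
elim: s => [|j s IHs]; last by rewrite !big_cons tproj_genDr IHs.
rewrite !big_nil; apply: (addrI (tproj_gen c n 0)).
by rewrite -tproj_genDr !addr0.
Qed.

Lemma tproj_gen_bal c n (s : HOM M M) m :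
  tproj_gen c ((s : S^c) *: n) m = tproj_gen c n (s m).
Proof.
have [sa [Fa [_ ha ->]]] := gr_span (mgrP N) n.
have [sb [Fb [_ hb ->]]] := gr_span (mgrP M) m.
have [sc [Fc [_ hc ->]]] := gr_span (HOMgrP M M) s.
rewrite scaler_sumr !tproj_gen_suml; apply: eq_bigr => a _.
rewrite (hom_sum (\sum_(i <- sc) Fc i)) !tproj_gen_sumr; apply: eq_bigr => b _.
rewrite hom_sumE tproj_gen_sumr.
have -> : (\sum_(i <- sc) Fc i : S^c) *: Fa a
          = \sum_(i <- sc) (Fc i : S^c) *: Fa a by exact: scaler_suml.
rewrite tproj_gen_suml; apply: eq_bigr => d _.
have h1 : mgr (a * d)%g ((Fc d : S^c) *: Fa a).
  exact: (mgrZ (hc d : rgr d (Fc d : S)) (ha a)).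
have h2 : mgr (d * b)%g (Fc d (Fb b)) by apply: hc.
by rewrite (tproj_gen_homog c h1 (hb b)) (tproj_gen_homog c (ha a) h2) mulgA tmk_bal.
Qed.

Definition tproj (c : G) : tensor N -> tensor N := tlift (tproj_gen c).

Lemma tproj_mk c n m : tproj c (tmk n m) = tproj_gen c n m.
Proof.
by apply: tlift_mk; [apply: tproj_genDl|apply: tproj_genDr|apply: tproj_gen_bal].
Qed.

Lemma tproj_sum c (J : Type) (s : seq J) (F : J -> tensor N) :
  tproj c (\sum_(j <- s) F j) = \sum_(j <- s) tproj c (F j).
Proof.
by apply: tlift_sum; [apply: tproj_genDl|apply: tproj_genDr|apply: tproj_gen_bal].
Qed.

Lemma tproj0 c : tproj c 0 = 0.
Proof.
by apply: tlift0; [apply: tproj_genDl|apply: tproj_genDr|apply: tproj_gen_bal].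
Qed.

Lemma tproj_homog c d t : tensor_gr c t -> tproj d t = if d == c then t else 0.
Proof.
move=> [s hs ->]; rewrite tproj_sum.
transitivity (\sum_(p <- s) if d == c then tmk p.1 p.2 else 0); last first.
  by case: eqP => // _; rewrite big1.
apply: eq_big_seq => p /hs[a [b [<- ha hb]]].
by rewrite tproj_mk (tproj_gen_homog _ ha hb).
Qed.

Lemma tensor_gr0 c : tensor_gr c 0.
Proof. by exists [::]; rewrite ?big_nil. Qed.

Lemma tensor_grB c x y : tensor_gr c x -> tensor_gr c y -> tensor_gr c (x - y).
Proof.
move=> [s hs ->] [t ht ->]; exists (s ++ tens_map (fun n => - n) id t).
  move=> p; rewrite mem_cat => /orP[/hs//|/mapP[q /ht[a [b [ab ha hb]]] ->]].
  exists a, b; split => //=; rewrite -[- _]sub0r.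
  by apply: (grB (mgrP N)) => //; apply: gr0 (mgrP N) _.
rewrite big_cat /= big_map -sumrN; congr (_ + _).
by apply: eq_bigr => p _; rewrite tmkNl.
Qed.

Lemma tensor_gr_mk a b n m : mgr a n -> mgr b m -> tensor_gr (a * b)%g (tmk n m).
Proof.
move=> hn hm; exists [:: (n, m)]; last by rewrite big_seq1.
by move=> p; rewrite inE => /eqP ->; exists a, b.
Qed.

Lemma homog_sumD (I : choiceType) (V : zmodType) (g : I -> set V) (i : I) x y :
  (forall i, g i 0) -> (forall i x y, g i x -> g i y -> g i (x - y)) ->
  homog_sum g x -> homog_sum g y -> homog_sum g (x + y).
Proof.
move=> h0 hB hx hy; rewrite -[y]opprK -[- y]sub0r.
by do 2?apply: homog_sumB => //; apply: (homog_sum0 h0 i).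
Qed.

Lemma tensor_grP : is_grading tensor_gr.
Proof.
have D := homog_sumD (1%g : G) tensor_gr0 tensor_grB.
have Z := homog_sum0 tensor_gr0 (1%g : G).
split; [exact: tensor_gr0|exact: tensor_grB| |].
- move=> t; have [s ->] := tensorP t.
  have sumP (J : Type) (u : seq J) (F : J -> tensor N) :
      (forall j, homog_sum tensor_gr (F j)) ->
      homog_sum tensor_gr (\sum_(j <- u) F j).
    move=> hF; elim: u => [|j u IHu]; rewrite ?big_nil ?big_cons //.
    exact: D.
  apply: (sumP) => -[n m] /=.
  rewrite -(gcomp_sum (mgrP N) n) -(gcomp_sum (mgrP M) m).
  rewrite (big_morph (fun n => tmk n _) (fun n n' => tmkDl n n' _) (tmk0l _ _)).
  apply: (sumP) => a.
  rewrite (big_morph (tmk _) (tmkDr _) (tmk0r _)); apply: sumP => b.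
  apply: (homog_sum_hom tensor_gr0).
  by apply: tensor_gr_mk; apply: gcomp_gr.
- move=> s F us hF F0 c sc; have := congr1 (tproj c) F0.
  rewrite tproj_sum (bigD1_seq c) //= (tproj_homog c (hF c)) eqxx.
  rewrite big1 => [|d dc]; last by rewrite (tproj_homog c (hF d)) eq_sym (negbTE dc).
  by rewrite addr0 tproj0.
Qed.

Lemma tensor_grZ a c (r : R^c) t :
  rgr a (r : R) -> tensor_gr c t -> tensor_gr (c * a)%g (r *: t).
Proof.
move=> hr [s hs ->]; exists (tens_map id (fun m => r *: m) s).
  move=> p /mapP[q /hs[b [d [<- hb hd]]] ->] /=.
  by exists b, (d * a)%g; rewrite mulgA; split => //; apply: mgrZ.
by rewrite big_map /= scaler_sumr; apply: eq_bigr => p _; rewrite tensZ.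
Qed.

Definition tensor_gmod : grRight R :=
  @GMod G (R^c) (@rgr _ R) _ (tensor N) tensor_gr tensor_grP tensor_grZ.

End TensorGrading.

Section TensorMap.
Variables (N N' : grRight S) (f : ghom N N').

Lemma ghomD x y : f (x + y) = f x + f y.
Proof. by have := ghom_linear f 1 x y; rewrite !scale1r. Qed.

Lemma ghomZ s x : f (s *: x) = s *: f x.
Proof. by have := ghom_linear f s x 0; rewrite ghom0 !addr0. Qed.

Definition tmap : tensor N -> tensor N' := tlift (fun n m => tmk (f n) m).

Lemma tmap_mk n m : tmap (tmk n m) = tmk (f n) m.
Proof.
by apply: tlift_mk => [? ? ?|? ? ?|? s ?];
  rewrite ?ghomD ?tmkDl ?tmkDr // ghomZ tmk_bal.
Qed.

Lemma tmapD t u : tmap (t + u) = tmap t + tmap u.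
Proof.
by apply: tliftD => [? ? ?|? ? ?|? s ?];
  rewrite ?ghomD ?tmkDl ?tmkDr // ghomZ tmk_bal.
Qed.

Lemma tmap_sum (s : seq (N * M)) :
  tmap (\sum_(p <- s) tmk p.1 p.2) = \sum_(p <- s) tmk (f p.1) p.2.
Proof.
rewrite (big_morph _ tmapD (_ : tmap 0 = 0)).
  by apply: eq_bigr => p _; rewrite tmap_mk.
by apply: (addrI (tmap 0)); rewrite -tmapD !addr0.
Qed.

Lemma tmap_linear : linear (tmap : tensor_gmod N -> tensor_gmod N').
Proof.
move=> r t u; rewrite tmapD; congr (_ + _).
have [s ->] := tensorP t; rewrite tmap_sum !scaler_sumr.
rewrite (eq_bigr (fun p => tmk p.1 (r *: p.2))); last by move=> p _; apply: tensZ.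
rewrite -(big_map (fun p => (p.1, r *: p.2)) xpredT (fun p => tmk p.1 p.2)).
rewrite tmap_sum big_map; apply: eq_bigr => p _; exact: esym (tensZ _ _ _).
Qed.

Lemma tmap_deg c (t : tensor_gmod N) :
  mgr c t -> mgr c (tmap t : tensor_gmod N').
Proof.
move=> [s hs ->]; rewrite tmap_sum; exists (tens_map f id s).
  move=> p /mapP[q /hs[a [b [<- ha hb]]] ->] /=.
  by exists a, b; split => //; apply: ghom_deg.
by rewrite big_map.
Qed.

Definition tensor_map : ghom (tensor_gmod N) (tensor_gmod N') :=
  GHom tmap_linear tmap_deg.

End TensorMap.

(* - (x)_S M : gr(S) -> gr(R)                                                 *)
Definition tensor_functor : functor (gr S) (gr R).
Proof.
refine (@Functor (gr S) (gr R) tensor_gmod tensor_map _ _).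
- move=> N; apply: ghomP => t /=; have [s ->] := tensorP t.
  by rewrite tmap_sum.
- move=> N N' N'' g f; apply: ghomP => t /=; have [s ->] := tensorP t.
  rewrite !tmap_sum.
  rewrite -(big_map (fun p => (f p.1, p.2)) xpredT (fun p => tmk p.1 p.2)).
  by rewrite tmap_sum big_map.
Defined.

Definition left_flat := exact_functor tensor_functor.
Definition left_faithfully_flat := faithfully_exact tensor_functor.
Definition faithfully_projective := faithfully_exact (HOM_from M).
Definition faithfully_injective := faithfully_exact_contra (HOM_into M).

End Tensor.

(* Main.v *)
(* An object N of a category of graded modules is self-CS-Rickart when every
   endomorphism f has an idempotent endomorphism e such that ker f is a
   graded submodule of im e meeting every nonzero graded submodule of im e;
   dually with ker e <= im f and N = W + im f implying W = N for the graded
   submodules W containing ker e. A degree-preserving endomorphism of S is the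
   multiplication by a degree-preserving f : M -> M, so f and e are shared by
   M and S, and it remains to move the test submodules between M and S:
   (1) (i) Y <= S goes to Y M: flatness makes Y (x) M -> M, y (x) m |-> f y m,
       injective if s |-> f s is injective on Y, so Y M meets ker f trivially.
       (ii) W <= M goes to {s | s M <= W} = HOM(M, W), and ker f = ann(f) M by
       flatness.
   (2) (i) W goes to {s | s M <= W}: lifting M -> M/W through the epimorphism
       M -> M/W induced by f shows that this right ideal together with f S
       is S. (ii) Y goes to Y M; faithful flatness gives Y = S from Y M = M.
   (3) (i) Y <= S goes to Y^perp = {m | Y m = 0}: if s |-> s f is injective on
       Y, then s f |-> s x extends to S, so x - f m is in Y^perp for some m.
       (ii) W goes to {s | s W = 0} = HOM(M/W, M). *)

From HB Require Import structures.
Require Import Defs.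
From mathcomp Require Import all_boot all_algebra.
From mathcomp Require Import boolp classical_sets.

Set Implicit Arguments.
Unset Strict Implicit.
Unset Printing Implicit Defensive.

Import GRing.Theory.
Local Open Scope ring_scope.

(** * Graded submodules, graded quotients and exactness *)

Section GradedModules.
Variables (G : groupType) (K : pzRingType) (kgr : G -> set K).
Variable act : G -> G -> G.
Implicit Types X Y Z : gmod kgr act.

Section Additivity.
Variables (X Y : gmod kgr act) (f : ghom X Y).

Lemma gmapD x y : f (x + y) = f x + f y.
Proof. by have := ghom_linear f 1 x y; rewrite !scale1r. Qed.

Lemma gmapZ k x : f (k *: x) = k *: f x.
Proof. by have := ghom_linear f k x 0; rewrite ghom0 !addr0. Qed.

Lemma gmapB x y : f (x - y) = f x - f y.
Proof. by rewrite gmapD -scaleN1r gmapZ scaleN1r. Qed.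

Lemma gmap_sum (J : Type) (s : seq J) (F : J -> X) :
  f (\sum_(j <- s) F j) = \sum_(j <- s) f (F j).
Proof. exact: (big_morph f gmapD (ghom0 f)). Qed.

(** The images of the components of [x] sum to [f x] and have the right degrees, and such a
    decomposition is unique. *)
Lemma gmap_comp x a : f (gcomp (mgrP X) x a) = gcomp (mgrP Y) (f x) a.
Proof.
apply/esym; apply: (@gcomp_uniq _ _ _ (mgrP Y) _ (gsupp (mgrP X) x)
  (fun a => f (gcomp (mgrP X) x a))).
- exact: gsupp_uniq.
- by move=> b; apply: ghom_deg; apply: gcomp_gr.
- by move=> b /gcomp_out ->; rewrite ghom0.
- by rewrite -gmap_sum gcomp_sum.
Qed.

Lemma gmap_inj : (forall x, f x = 0 -> x = 0) -> injective f.
Proof. by move=> f0 x y fxy; apply/subr0_eq/f0; rewrite gmapB fxy subrr. Qed.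

End Additivity.

Definition ghom_sub X Y (f g : ghom X Y) : ghom X Y.
Proof.
refine (@GHom _ _ _ _ X Y (fun x => f x - g x) _ _).
  by move=> k x y; rewrite !gmapD !gmapZ scalerBr opprD addrACA.
by move=> a x ax; apply: (grB (mgrP Y)); apply: ghom_deg.
Defined.

(** Submodules are encoded as predicates; closure under homogeneous components, [gsubC], is what
    makes them graded. *)
Record gsub X := GSub {
  gset :> X -> Prop;
  gsub0 : gset 0;
  gsubB : forall x y, gset x -> gset y -> gset (x - y);
  gsubZ : forall k x, gset x -> gset (k *: x);
  gsubC : forall x a, gset x -> gset (gcomp (mgrP X) x a) }.

Lemma gsubD X (W : gsub X) x y : W x -> W y -> W (x + y).
Proof.
move=> Wx Wy; rewrite -[y]opprK -[- y]sub0r.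
by apply: gsubB => //; apply: gsubB => //; apply: gsub0.
Qed.

Lemma gsub_sum X (W : gsub X) (J : eqType) (s : seq J) (F : J -> X) :
  (forall j, j \in s -> W (F j)) -> W (\sum_(j <- s) F j).
Proof.
move=> WF; rewrite big_seq; elim/big_ind: _ => //; [exact: gsub0|exact: gsubD].
Qed.

Definition gsub_full X : gsub X := @GSub X (fun=> True) I (fun _ _ _ _ => I)
  (fun _ _ _ => I) (fun _ _ _ => I).

Definition gker X Y (f : ghom X Y) : gsub X.
Proof.
refine (@GSub X (fun x => f x = 0) (ghom0 f) _ _ _).
- by move=> x y fx fy; rewrite gmapB fx fy subrr.
- by move=> k x fx; rewrite gmapZ fx scaler0.
- by move=> x a fx; rewrite gmap_comp fx gcomp0.
Defined.

Definition gimage X Y (f : ghom X Y) (W : gsub X) : gsub Y.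
Proof.
refine (@GSub Y (fun y => exists2 x, W x & f x = y) _ _ _ _).
- by exists 0; [exact: gsub0|exact: ghom0].
- move=> _ _ [x Wx <-] [y Wy <-]; exists (x - y); first exact: gsubB.
  exact: gmapB.
- by move=> k _ [x Wx <-]; exists (k *: x); [exact: gsubZ|exact: gmapZ].
- move=> _ a [x Wx <-]; exists (gcomp (mgrP X) x a); first exact: gsubC.
  exact: gmap_comp.
Defined.

Definition gpreim X Y (f : ghom X Y) (W : gsub Y) : gsub X.
Proof.
refine (@GSub X (fun x => W (f x)) _ _ _ _).
- by rewrite ghom0; apply: gsub0.
- by move=> x y Wx Wy; rewrite gmapB; apply: gsubB.
- by move=> k x Wx; rewrite gmapZ; apply: gsubZ.
- by move=> x a Wx; rewrite gmap_comp; apply: gsubC.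
Defined.

(** * Graded submodules as graded modules *)

Section Submodule.
Variables (X : gmod kgr act) (W : gsub X).

(** Membership is made boolean, so that elements with equal values are equal and the subtype
    inherits a choice structure. *)
Definition sub_sort := {x : X | `[< W x >]}.
HB.instance Definition _ := Choice.on sub_sort.

Let inS x (Wx : W x) : sub_sort := exist _ x (asboolT Wx).
Let subP (w : sub_sort) : W (val w). Proof. exact: asboolW (valP w). Qed.

Definition sub_zero : sub_sort := inS (gsub0 W).
Definition sub_add (u v : sub_sort) : sub_sort := inS (gsubD (subP u) (subP v)).
Definition sub_opp (u : sub_sort) : sub_sort := inS (gsubB (gsub0 W) (subP u)).
Definition sub_scale k (u : sub_sort) : sub_sort := inS (gsubZ k (subP u)).

Lemma sub_addA : associative sub_add.
Proof. by move=> u v w; apply: val_inj; rewrite /= addrA. Qed.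
Lemma sub_addC : commutative sub_add.
Proof. by move=> u v; apply: val_inj; rewrite /= addrC. Qed.
Lemma sub_add0 : left_id sub_zero sub_add.
Proof. by move=> u; apply: val_inj; rewrite /= add0r. Qed.
Lemma sub_addN : left_inverse sub_zero sub_opp sub_add.
Proof. by move=> u; apply: val_inj; rewrite /= sub0r addNr. Qed.

HB.instance Definition _ := GRing.isZmodule.Build sub_sort
  sub_addA sub_addC sub_add0 sub_addN.

Lemma sub_scaleA k l u : sub_scale k (sub_scale l u) = sub_scale (k * l) u.
Proof. by apply: val_inj; rewrite /= scalerA. Qed.
Lemma sub_scale1 : left_id 1 sub_scale.
Proof. by move=> u; apply: val_inj; rewrite /= scale1r. Qed.
Lemma sub_scaleDr : right_distributive sub_scale +%R.
Proof. by move=> k u v; apply: val_inj; rewrite /= scalerDr. Qed.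
Lemma sub_scaleDl u : {morph sub_scale^~ u : k l / k + l >-> k + l}.
Proof. by move=> k l; apply: val_inj; rewrite /= scalerDl. Qed.

HB.instance Definition _ := GRing.Zmodule_isLmodule.Build K sub_sort
  sub_scaleA sub_scale1 sub_scaleDr sub_scaleDl.

Definition sub_gr (a : G) : set sub_sort := fun u => mgr a (val u).

Lemma sub_valB (u v : sub_sort) : val (u - v) = val u - val v.
Proof. by rewrite /= sub0r. Qed.

Lemma sub_val_sum (J : Type) (s : seq J) (F : J -> sub_sort) :
  val (\sum_(j <- s) F j) = \sum_(j <- s) val (F j).
Proof. exact: (big_morph val). Qed.

Lemma sub_grP : is_grading sub_gr.
Proof.
split.
- by move=> a; apply: gr0 (mgrP X) a.
- by move=> a u v ua va; rewrite /sub_gr sub_valB; apply: (grB (mgrP X)).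
- move=> u; exists (gsupp (mgrP X) (val u)), (fun a => inS (gsubC a (subP u))).
  split; [exact: gsupp_uniq|by move=> a; apply: gcomp_gr|].
  by apply: val_inj; rewrite sub_val_sum /= gcomp_sum.
- move=> s F us Fgr F0 a sa; apply: val_inj.
  have sF0 : \sum_(b <- s) val (F b) = 0 by rewrite -sub_val_sum F0.
  exact: (gr_direct (mgrP X) us Fgr sF0 sa).
Qed.

Definition sub_gmod : gmod kgr act :=
  @GMod G K kgr act sub_sort sub_gr sub_grP
    (fun a b k x hk hx => mgrZ hk hx).

Definition sub_incl : ghom sub_gmod X :=
  @GHom _ _ _ _ sub_gmod X val (fun _ _ _ => erefl) (fun _ _ h => h).

Lemma sub_incl_inj : injective sub_incl. Proof. exact: val_inj. Qed.
Lemma sub_inclP w : W (sub_incl w). Proof. exact: subP. Qed.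
Lemma sub_incl_surj x : W x -> exists w, sub_incl w = x.
Proof. by move=> Wx; exists (inS Wx). Qed.

End Submodule.

(** * Quotients by graded submodules *)

Section Quotient.
Variables (X : gmod kgr act) (W : gsub X).

(** The choice depends only on the coset of [x], so it is a canonical representative, and the
    quotient will consist of these. The default 0 is never reached, since the coset contains [x]. *)
Definition quot_repr (x : X) : X := xget 0 (fun y => W (x - y)).

Lemma quot_reprP x : W (x - quot_repr x).
Proof.
apply: (@xgetPex _ 0 (fun y => W (x - y))).
by exists x; rewrite subrr; apply: gsub0.
Qed.

Lemma quot_repr_eq x y : W (x - y) -> quot_repr x = quot_repr y.
Proof.
move=> Wxy; congr xget; apply/funext => z; apply/propext; split=> h.
  have -> : y - z = (x - z) - (x - y) by rewrite opprB [RHS]addrC subrKA.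
  exact: gsubB.
by rewrite -[x](subrK y) -addrA; apply: gsubD.
Qed.

Definition quot_sort := {x : X | quot_repr x == x}.
HB.instance Definition _ := Choice.on quot_sort.

Lemma quot_repr_idem x : quot_repr (quot_repr x) == quot_repr x.
Proof. by apply/eqP/esym/quot_repr_eq/quot_reprP. Qed.

Definition quot_pi x : quot_sort := exist _ (quot_repr x) (quot_repr_idem x).

Lemma quot_val u : quot_pi (val u) = u.
Proof. by apply: val_inj; rewrite /= (eqP (valP u)). Qed.

Lemma quot_piP x y : quot_pi x = quot_pi y <-> W (x - y).
Proof.
split => [/(congr1 val) /= xy|/quot_repr_eq xy]; last exact: val_inj.
have -> : x - y = (x - quot_repr x) - (y - quot_repr y).
  by rewrite xy opprB addrA subrK.
by apply: gsubB; apply: quot_reprP.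
Qed.

Definition quot_add (u v : quot_sort) := quot_pi (val u + val v).
Definition quot_opp (u : quot_sort) := quot_pi (- val u).
Definition quot_scale k (u : quot_sort) := quot_pi (k *: val u).

Lemma quot_addE x y : quot_add (quot_pi x) (quot_pi y) = quot_pi (x + y).
Proof.
apply/quot_piP; rewrite opprD addrACA.
apply: gsubD; rewrite -opprB -sub0r; apply: gsubB (gsub0 W) _.
  exact: quot_reprP.
exact: quot_reprP.
Qed.

Lemma quot_oppE x : quot_opp (quot_pi x) = quot_pi (- x).
Proof. by apply/quot_piP; rewrite opprK addrC; apply: quot_reprP. Qed.

Lemma quot_scaleE k x : quot_scale k (quot_pi x) = quot_pi (k *: x).
Proof.
apply/quot_piP; rewrite -scalerBr; apply: gsubZ; rewrite -opprB -sub0r.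
by apply: gsubB (gsub0 W) _; apply: quot_reprP.
Qed.

Lemma quot_addA : associative quot_add.
Proof.
move=> u v w; rewrite -[u]quot_val -[v]quot_val -[w]quot_val.
by rewrite !quot_addE addrA.
Qed.
Lemma quot_addC : commutative quot_add.
Proof. by move=> u v; rewrite /quot_add addrC. Qed.
Lemma quot_add0 : left_id (quot_pi 0) quot_add.
Proof. by move=> u; rewrite -[u]quot_val quot_addE add0r. Qed.
Lemma quot_addN : left_inverse (quot_pi 0) quot_opp quot_add.
Proof. by move=> u; rewrite -[u]quot_val quot_oppE quot_addE addNr. Qed.

HB.instance Definition _ := GRing.isZmodule.Build quot_sort
  quot_addA quot_addC quot_add0 quot_addN.

Lemma quot_scaleA k l u : quot_scale k (quot_scale l u) = quot_scale (k * l) u.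
Proof. by rewrite -[u]quot_val !quot_scaleE scalerA. Qed.
Lemma quot_scale1 : left_id 1 quot_scale.
Proof. by move=> u; rewrite -[u]quot_val quot_scaleE scale1r. Qed.
Lemma quot_scaleDr : right_distributive quot_scale +%R.
Proof.
move=> k u v; rewrite -[u]quot_val -[v]quot_val [_ + _]quot_addE !quot_scaleE.
by rewrite [RHS]quot_addE scalerDr.
Qed.
Lemma quot_scaleDl u : {morph quot_scale^~ u : k l / k + l >-> k + l}.
Proof.
move=> k l; rewrite -[u]quot_val !quot_scaleE [RHS]quot_addE.
by rewrite scalerDl.
Qed.

HB.instance Definition _ := GRing.Zmodule_isLmodule.Build K quot_sort
  quot_scaleA quot_scale1 quot_scaleDr quot_scaleDl.

Lemma quot_pi_linear : linear quot_pi.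
Proof. by move=> k x y; rewrite -quot_addE -quot_scaleE. Qed.

Lemma quot_pi_sum (J : Type) (s : seq J) (F : J -> X) :
  quot_pi (\sum_(j <- s) F j) = \sum_(j <- s) quot_pi (F j).
Proof. by apply: (big_morph quot_pi) => // x y; rewrite [RHS]quot_addE. Qed.

Lemma quot_pi0 x : quot_pi x = 0 <-> W x.
Proof. by rewrite -[in W x](subr0 x); apply: quot_piP. Qed.

Definition quot_gr (a : G) : set quot_sort :=
  fun u => exists2 x, mgr a x & quot_pi x = u.

Lemma quot_grP : is_grading quot_gr.
Proof.
split.
- by move=> a; exists 0 => //; apply: gr0 (mgrP X) a.
- move=> a _ _ [x xa <-] [y ya <-]; exists (x - y); first exact: (grB (mgrP X)).
  by rewrite -quot_addE -quot_oppE.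
- move=> u; exists (gsupp (mgrP X) (val u)),
    (fun a => quot_pi (gcomp (mgrP X) (val u) a)).
  split; first exact: gsupp_uniq.
    by move=> a; exists (gcomp (mgrP X) (val u) a) => //; apply: gcomp_gr.
  by rewrite -quot_pi_sum gcomp_sum quot_val.
- move=> s F us Fgr F0 a sa.
  have /choice[x xP] : forall b, exists x, mgr b x /\ quot_pi x = F b.
    by move=> b; have [x] := Fgr b; exists x.
  (* The homogeneous lifts [x b] have their sum in [W], so [W] contains the components of this sum,
     among them [x a]. *)
  have Wx : W (\sum_(b <- s) x b).
    apply/quot_pi0; rewrite quot_pi_sum -[RHS]F0.
    by apply: eq_bigr => b _; rewrite (xP b).2.
  rewrite -(xP a).2; apply/quot_pi0.
  have := gsubC a Wx; congr (W _).
  rewrite (@gcomp_uniq _ _ _ (mgrP X) _ s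
    (fun b => if b \in s then x b else 0)) ?sa //.
  + by move=> b; case: ifP => _; [apply: (xP b).1|apply: gr0 (mgrP X) b].
  + by move=> b /negbTE ->.
  + by apply: eq_big_seq => b ->.
Qed.

Lemma quot_grZ a b (k : K) u :
  kgr a k -> quot_gr b u -> quot_gr (act a b) (k *: u).
Proof.
move=> ka [x xb <-]; exists (k *: x); first exact: mgrZ.
by rewrite [RHS]quot_scaleE.
Qed.

Definition quot_gmod : gmod kgr act :=
  @GMod G K kgr act quot_sort quot_gr quot_grP quot_grZ.

Definition quot_proj : ghom X quot_gmod :=
  @GHom _ _ _ _ X quot_gmod quot_pi quot_pi_linear
    (fun a x h => ex_intro2 _ _ x h erefl).

Lemma quot_proj_surj u : exists x, quot_proj x = u.
Proof. by exists (val u); apply: quot_val. Qed.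

Lemma quot_proj0 x : quot_proj x = 0 <-> W x.
Proof. exact: quot_pi0. Qed.

End Quotient.

(** Compose [f] with a set-theoretic section of [p]; the inclusion of kernels makes the result
    independent of the section, hence linear. *)
Lemma ghom_factor_surj X Y Z (p : ghom X Y) (f : ghom X Z) :
  (forall y, exists x, p x = y) -> (forall x, p x = 0 -> f x = 0) ->
  exists g : ghom Y Z, forall x, g (p x) = f x.
Proof.
move=> /choice[s ps] p0.
have E x y : p x = p y -> f x = f y.
  by move=> pxy; apply/subr0_eq; rewrite -gmapB p0 // gmapB pxy subrr.
have gl : linear (f \o s : Y -> Z).
  move=> k x y /=; rewrite -gmapZ -gmapD; apply: E.
  by rewrite gmapD gmapZ !ps.
have gd a (y : Y) : mgr a y -> mgr a ((f \o s) y).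
  (* The section may ignore degrees, but the component of degree [a] of the chosen lift is again a
     lift of the homogeneous [y]. *)
  move=> ya /=; rewrite (E _ (gcomp (mgrP X) (s y) a)).
    by apply: ghom_deg; apply: gcomp_gr.
  by rewrite gmap_comp ps (gcomp_homog _ _ ya) eqxx.
by exists (GHom gl gd) => x; apply: E; rewrite ps.
Qed.

Lemma ghom_factor_inj X Y Z (i : ghom X Y) (f : ghom Z Y) :
  injective i -> (forall z, exists x, i x = f z) ->
  exists g : ghom Z X, forall z, i (g z) = f z.
Proof.
move=> ii /choice[g ig].
have gl : linear (g : Z -> X).
  by move=> k x y; apply: ii; rewrite gmapD gmapZ !ig gmapD gmapZ.
have gd a (z : Z) : mgr a z -> mgr a (g z).
  move=> za; have -> : g z = gcomp (mgrP X) (g z) a; last exact: gcomp_gr.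
  apply: ii; rewrite gmap_comp ig.
  by rewrite (gcomp_homog _ _ (ghom_deg f za)) eqxx.
by exists (GHom gl gd).
Qed.

Lemma ghom_eqP X Y (f g : ghom X Y) : f = g -> f =1 g.
Proof. by move=> ->. Qed.

Local Notation C := (gcat kgr act).

(** A monomorphism cannot distinguish the inclusion of its kernel from zero. *)
Lemma gmono_injective X Y (f : ghom X Y) : is_mono (C := C) f <-> injective f.
Proof.
split=> [mf|fi T g h fgh]; last first.
  by apply: ghomP => x; apply: fi; apply: (ghom_eqP fgh x).
apply: gmap_inj => x fx.
have [w <-] := sub_incl_surj (fx : gker f x).
have incl0 : sub_incl (gker f) = ghom_zero _ _.
  by apply: mf; apply: ghomP => u /=; rewrite ghom0; apply: (sub_inclP u).
by rewrite incl0.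
Qed.

(** The projection modulo the image of an epimorphism agrees with zero after composition, so it is
    zero. *)
Lemma gepi_surjective X Y (f : ghom X Y) :
  is_epi (C := C) f <-> forall y, exists x, f x = y.
Proof.
split=> [ef y|fs T g h gfh]; last first.
  apply: ghomP => y; have [x <-] := fs y.
  exact: (ghom_eqP gfh x).
pose W := gimage f (gsub_full X).
suff /quot_proj0[x _ <-] : quot_proj W y = 0 by exists x.
have -> : quot_proj W = ghom_zero _ _; last by [].
by apply: ef; apply: ghomP => x /=; apply/(@quot_proj0 _ W); exists x.
Qed.

Lemma kernelP X Y Z (f : ghom X Y) (k : ghom Z X) :
  is_kernel (C := C) f k <->
  injective k /\ forall x, f x = 0 <-> exists z, k z = x.
Proof.
split=> [[fk ku]|[ki kE]].
  split.
    apply/gmono_injective => T g h kgh.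
    have [|u [_ uu]] := ku T (ghom_comp k g).
      by apply: ghomP => x /=; apply: (ghom_eqP fk (g x)).
    by rewrite -(uu g) // -(uu h).
  move=> x; split=> [fx|[z <-]]; last first.
    exact: (ghom_eqP fk z).
  have [|u [kuE _]] := ku _ (sub_incl (gker f)).
    by apply: ghomP => w; apply: (sub_inclP w).
  have [w <-] := sub_incl_surj (fx : gker f x).
  by exists (u w); rewrite -kuE.
split; first by apply: ghomP => z; apply/kE; exists z.
move=> T t /ghom_eqP ft.
have [|u uE] := @ghom_factor_inj _ _ _ k t ki.
  by move=> z; apply/kE; apply: ft.
exists u; split=> [|v kv]; first exact: ghomP.
by apply: ghomP => z; apply: ki; rewrite uE -kv.
Qed.

Lemma cokernelP X Y Z (f : ghom X Y) (c : ghom Y Z) :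
  is_cokernel (C := C) f c <->
  (forall z, exists y, c y = z) /\ forall y, c y = 0 <-> exists x, f x = y.
Proof.
split=> [[cf cu]|[cs cE]].
  split.
    apply/gepi_surjective => T g h ghc.
    have [|u [_ uu]] := cu T (ghom_comp g c).
      apply: ghomP => x /=; have /= -> := ghom_eqP cf x.
      exact: ghom0.
    by rewrite -(uu g) // -(uu h).
  move=> y; split=> [cy|[x <-]]; last first.
    exact: (ghom_eqP cf x).
  pose W := gimage f (gsub_full X).
  have [|u [ucE _]] := cu _ (quot_proj W).
    by apply: ghomP => x; apply/(@quot_proj0 _ W); exists x.
  suff /quot_proj0[x _ <-] : quot_proj W y = 0 by exists x.
  by rewrite -ucE /= cy ghom0.
split; first by apply: ghomP => x; apply/cE; exists x.
move=> T t /ghom_eqP tf.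
have [|u uE] := @ghom_factor_surj _ _ _ c t cs.
  by move=> y /cE[x <-]; apply: tf.
exists u; split=> [|v vc]; first exact: ghomP.
by apply: ghomP => z; have [y <-] := cs z; rewrite uE -vc.
Qed.

(** For the converse, the projection modulo the image of [f] is the cokernel, and the inclusion of
    [gker g] is both the image and the kernel. *)
Lemma exact_atP X Y Z (f : ghom X Y) (g : ghom Y Z) :
  exact_at (C := C) f g <-> forall y, g y = 0 <-> exists x, f x = y.
Proof.
split=> [[Q [I [c [i []]]]]|fgE].
  move=> /cokernelP[_ cE] /kernelP[_ iE] /kernelP[_ gE] y.
  by rewrite gE -iE cE.
pose W := gimage f (gsub_full X).
have WE y : quot_proj W y = 0 <-> exists x, f x = y.
  by rewrite quot_proj0; split=> [[x _ <-]|[x <-]]; exists x.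
have gE y : (exists z, sub_incl (gker g) z = y) <-> g y = 0.
  by split=> [[z <-]|gy]; [exact: (sub_inclP z)|exact: sub_incl_surj].
exists (quot_gmod W), (sub_gmod (gker g)), (quot_proj W), (sub_incl (gker g)).
split.
- by apply/cokernelP; split; [exact: quot_proj_surj|exact: WE].
- by apply/kernelP; split=> [|y]; [exact: sub_incl_inj|rewrite gE WE fgE].
- by apply/kernelP; split=> [|y]; [exact: sub_incl_inj|rewrite gE].
Qed.

End GradedModules.

(** * Elementwise forms of the Rickart conditions *)

Section CSRickart.
Variables (G : groupType) (K : pzRingType) (kgr : G -> set K).
Variable act : G -> G -> G.
Implicit Types N X Y Z : gmod kgr act.
Local Notation C := (gcat kgr act).

(** For an idempotent [e] this is the image of [e], a direct summand of [N]. *)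
Definition gfix N (e : ghom N N) : gsub N := gker (ghom_sub (ghom_id N) e).

Lemma gfixP N (e : ghom N N) x : gfix e x <-> e x = x.
Proof. by split=> [/subr0_eq|/= ->] //; rewrite subrr. Qed.

Lemma retract_split N X (r : ghom N X) (s : ghom X N) :
  ghom_comp r s = ghom_id X -> forall x, r (s x) = x.
Proof. by move=> rs x; apply: (ghom_eqP rs). Qed.

(** A section [s] with left inverse [s'] gives the idempotent [s s']; conversely [L] is [gfix e].
    Essentiality becomes a test on submodules because a morphism is mono exactly when its kernel is
    zero. *)
Lemma self_CS_RickartP N : self_CS_Rickart (C := C) N <->
  forall f : ghom N N, exists e : ghom N N,
    [/\ forall x, e (e x) = e x, forall x, f x = 0 -> e x = x &
        forall W : gsub N, (forall x, W x -> e x = x) ->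
          (forall x, W x -> f x = 0 -> x = 0) -> forall x, W x -> x = 0].
Proof.
split=> NCS f.
  have [Z [k [/kernelP[ki kE] [L [u [s [uess [s' /retract_split s'K] ksu]]]]]]]
    := NCS f.
  case: uess => /gmono_injective ui uess.
  have kx x : k x = s (u x) by rewrite ksu.
  exists (ghom_comp s s'); split=> [x|x /kE[z <-]|W We Wf x Wx].
  - by rewrite /= s'K.
  - by rewrite /= kx s'K.
  (* Since [W] meets ker [f] trivially, the projection modulo the preimage of [W] is mono on ker
     [f]; essentiality makes it mono, so this preimage is zero. *)
  have /gmono_injective qi : is_mono (C := C) (quot_proj (gpreim s W)).
    apply: uess; apply/gmono_injective/gmap_inj => z /quot_proj0 Wz.
    apply: ki; rewrite ghom0; apply: Wf; rewrite kx //.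
    by rewrite -kx; apply/kE; exists z.
  rewrite -(We x Wx) /=; suff -> : s' x = 0 by rewrite ghom0.
  apply: qi; rewrite ghom0; apply/quot_proj0.
  by rewrite /= -[s _]/(ghom_comp s s' x) We.
have [e [eK fe Wess]] := NCS f.
pose s := sub_incl (gfix e).
have eS x : e (s x) = s x by apply/gfixP/sub_inclP.
have [s' s'E] : exists s' : ghom N (sub_gmod (gfix e)),
    forall x, s (s' x) = e x.
  apply: ghom_factor_inj; first exact: sub_incl_inj.
  by move=> x; apply: sub_incl_surj; apply/gfixP.
pose k := sub_incl (gker f).
have [u uE] : exists u : ghom (sub_gmod (gker f)) (sub_gmod (gfix e)),
    forall x, s (u x) = k x.
  apply: ghom_factor_inj; first exact: sub_incl_inj.
  move=> x; apply: sub_incl_surj; apply/gfixP; apply: fe; exact: (sub_inclP x).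
exists (sub_gmod (gker f)), k; split.
  apply/kernelP; split=> [|x]; first exact: sub_incl_inj.
  by split=> [fx|[z <-]]; [exact: sub_incl_surj|exact: (sub_inclP z)].
exists (sub_gmod (gfix e)), u, s; split; last by apply: ghomP => x; rewrite -uE.
  split=> [|P h /gmono_injective hui].
    apply/gmono_injective => x y uxy; apply: (sub_incl_inj (W := gker f)).
    by rewrite -[LHS]uE uxy uE.
  apply/gmono_injective/gmap_inj => x hx.
  apply: (sub_incl_inj (W := gfix e)).
  (* The test submodule is the kernel of [h], moved into [N]; its elements killed by [f] come from
     some [z] in ker [f] with [h (u z) = 0]. *)
  rewrite ghom0; apply: (Wess (gimage s (gker h))); last by exists x.
    by move=> _ [y _ <-].
  move=> _ [y hy <-] fsy.
  have [z zE] := sub_incl_surj (fsy : gker f (s y)).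
  have uz : u z = y.
    by apply: (sub_incl_inj (W := gfix e)); rewrite -[RHS]zE; apply: uE.
  rewrite -uz; suff -> : z = 0 by rewrite !ghom0.
  by apply: hui; rewrite /= uz hy !ghom0.
exists s'; apply: ghomP => x; apply: (sub_incl_inj (W := gfix e)).
by rewrite -[LHS]/(s (s' (s x))) s'E eS.
Qed.

(** A retraction [r] with right inverse [r'] gives the idempotent [r' r]; conversely [P] is
    [gfix e], and [r] is [e] with values in its image. *)
Lemma dual_self_CS_RickartP N : dual_self_CS_Rickart (C := C) N <->
  forall f : ghom N N, exists e : ghom N N,
    [/\ forall x, e (e x) = e x, forall x, e x = 0 -> exists y, f y = x &
        forall W : gsub N, (forall x, e x = 0 -> W x) ->
          (forall x, exists2 w, W w & exists y, x = w + f y) -> forall x, W x].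
Proof.
split=> NCS f.
  have [Q [c [/cokernelP[cs cE] [P [r [t [[r' /retract_split rK] tsup crt]]]]]]]
    := NCS f.
  case: tsup => /gepi_surjective ts tsup.
  have cx x : c x = t (r x) by rewrite crt.
  exists (ghom_comp r' r); split=> [x|x ex|W We Wf x].
  - by rewrite /= rK.
  - by apply/cE; rewrite cx -[r x]rK -[r' (r x)]/(ghom_comp r' r x) ex !ghom0.
  (* As [W] + im [f] is everything, [t] maps [r(W)] onto the cokernel; superfluity gives [r(W) = P],
     so each [x] differs from some [w] in [W] by an element of ker [e]. *)
  have /gepi_surjective incl_surj : is_epi (C := C) (sub_incl (gimage r W)).
    apply: tsup; apply/gepi_surjective => q; have [x' <-] := cs q.
    have [w Ww [y ->]] := Wf x'.
    have [v vE] := sub_incl_surj (ex_intro2 _ _ w Ww erefl : gimage r W (r w)).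
    exists v; rewrite /= -[val v]/(sub_incl _ v) vE -cx gmapD.
    by rewrite (cE (f y)).2 ?addr0 //; exists y.
  have [v vE] := incl_surj (r x).
  have [w Ww rw] := sub_inclP v.
  rewrite -(subrK w x); apply: gsubD => //; apply: We.
  by rewrite /= gmapB rw vE subrr ghom0.
have [e [eK fe Wsup]] := NCS f.
pose s := sub_incl (gfix e).
have eS x : e (s x) = s x by apply/gfixP/sub_inclP.
have [r rE] : exists r : ghom N (sub_gmod (gfix e)), forall x, s (r x) = e x.
  apply: ghom_factor_inj; first exact: sub_incl_inj.
  by move=> x; apply: sub_incl_surj; apply/gfixP.
have rK x : r (s x) = x.
  by apply: (sub_incl_inj (W := gfix e)); rewrite -[LHS]/(s _) rE eS.
pose W := gimage f (gsub_full N); pose c := quot_proj W.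
have cE x : c x = 0 <-> exists y, f y = x.
  by rewrite quot_proj0; split=> [[y _ <-]|[y <-]]; exists y.
have cr x : c x = c (s (r x)).
  by apply/subr0_eq; rewrite -gmapB; apply/cE/fe; rewrite gmapB rE eK subrr.
exists (quot_gmod W), c; split.
  by apply/cokernelP; split; [exact: quot_proj_surj|exact: cE].
exists (sub_gmod (gfix e)), r, (ghom_comp c s); split; last by apply: ghomP.
  by exists s; apply: ghomP.
split=> [|Z h /gepi_surjective ths].
  apply/gepi_surjective => q; have [x <-] := quot_proj_surj q.
  by exists (r x); rewrite [RHS]cr.
apply/gepi_surjective => y.
(* [Wh] contains ker [e], where [r] vanishes, and together with im [f] it spans [N] because [c s h]
   is onto. So it contains [s y], and [y = r (s y)] is in the image of [h]. *)
pose Wh := gpreim r (gimage h (gsub_full Z)).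
have [|x|z _ zE] := Wsup Wh _ _ (s y); last first.
- by exists z; rewrite zE rK.
- have [z zE] := ths (c x); exists (s (h z)); first by exists z; rewrite ?rK.
  have [y' y'E] : exists y', f y' = x - s (h z).
    by apply/cE; rewrite gmapB -zE subrr.
  by exists y'; rewrite y'E addrC subrK.
- move=> x ex; exists 0 => //; apply: (sub_incl_inj (W := gfix e)).
  by rewrite -[RHS]/(s _) rE ex !ghom0.
Qed.

End CSRickart.

(** * Submodules of M and one-sided ideals of END(M) *)

Section HomComponents.
Variables (G : groupType) (R : gradedRing G) (X Y : grRight R).

(** On an [x] of degree [b], the components of [s] take values in distinct degrees, so these values
    are the components of [s x]. This makes the ideals built from submodules of [M] graded. *)
Lemma HOM_gcomp_map (s : HOM X Y) a b x : mgr b x ->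
  gcomp (HOMgrP X Y) s a x = gcomp (mgrP Y) (s x) (a * b)%g.
Proof.
move=> xb; set sc := gcomp _ s.
rewrite (@gcomp_uniq _ _ _ (mgrP Y) _ [seq c * b | c <- gsupp (HOMgrP X Y) s]%g
  (fun d => sc (d * b^-1)%g x)) ?mulgK //.
- by rewrite map_inj_uniq ?gsupp_uniq //; apply: mulIg.
- by move=> d; rewrite -{1}[d](mulgVK b); apply: (gcomp_gr (HOMgrP X Y) s).
- move=> d db; rewrite /sc gcomp_out ?hom0E //.
  by apply: contra db => db; apply/mapP; exists (d * b^-1)%g; rewrite ?mulgVK.
- rewrite big_map -{1}[s](gcomp_sum (HOMgrP X Y)) hom_sumE.
  by apply: eq_bigr => c _; rewrite mulgK.
Qed.

Lemma HOM_map_gcomp (s : HOM X Y) a b x : HOMgr a s ->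
  s (gcomp (mgrP X) x b) = gcomp (mgrP Y) (s x) (a * b)%g.
Proof.
move=> sa.
rewrite (@gcomp_uniq _ _ _ (mgrP Y) _ [seq a * c | c <- gsupp (mgrP X) x]%g
  (fun d => s (gcomp (mgrP X) x (a^-1 * d)%g))) ?mulKg //.
- by rewrite map_inj_uniq ?gsupp_uniq //; apply: mulgI.
- by move=> d; rewrite -{1}[d](mulVKg a); apply: sa; apply: gcomp_gr.
- move=> d db; rewrite gcomp_out ?hom0 //.
  by apply: contra db => db; apply/mapP; exists (a^-1 * d)%g; rewrite ?mulVKg.
- rewrite big_map -{1}[x](gcomp_sum (mgrP X)) hom_sum.
  by apply: eq_bigr => c _; rewrite mulKg.
Qed.

End HomComponents.

Section Endomorphisms.
Variables (G : groupType) (R : gradedRing G) (M : grRight R).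
Local Notation S := (END M).
Implicit Types (f e : ghom M M) (W : gsub M).

Lemma HOMgr_id : HOMgr 1%g (HOM_id M).
Proof. by move=> b x; rewrite mul1g. Qed.

Definition lmul f : ghom (regR S) (regR S).
Proof.
refine (@GHom _ _ _ _ (regR S) (regR S)
  (fun s : HOM M M => HOM_comp (HOM_of f) s) _ _).
  move=> k s t; rewrite [LHS](HOM_compDr (HOM_of f)); congr (_ + _).
  exact: HOMP.
by move=> a s sa; have := HOMgr_comp (HOMgr_of f) sa; rewrite mul1g.
Defined.

Definition rmul f : ghom (regL S) (regL S).
Proof.
refine (@GHom _ _ _ _ (regL S) (regL S)
  (fun s : HOM M M => HOM_comp s (HOM_of f)) _ _).
  move=> k s t; rewrite [LHS](HOM_compDl _ _ (HOM_of f)); congr (_ + _).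
  exact: HOMP.
by move=> a s sa; have := HOMgr_comp sa (HOMgr_of f); rewrite mulg1.
Defined.

Lemma HOMgr1_ghom (s : HOM M M) : HOMgr 1%g s -> exists f, HOM_of f = s.
Proof.
move=> s1.
have sd a (x : M) : mgr a x -> mgr a (s x) by move=> /s1; rewrite mul1g.
by exists (GHom (@HOM_linear _ _ _ _ s) sd); apply: HOMP.
Qed.

(** An endomorphism of the regular module is determined by its value at the identity, which is
    homogeneous of degree 1, hence a degree-preserving map. *)
Lemma regR_endo (g : ghom (regR S) (regR S)) : exists f, g = lmul f.
Proof.
have [f fE] : exists f, HOM_of f = g (HOM_id M).
  by apply: HOMgr1_ghom; apply: (ghom_deg g); apply: HOMgr_id.
exists f; apply: ghomP => s; rewrite /= fE.
have {1}-> : s = (s : S^c) *: (HOM_id M : regR S) by apply: HOMP.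
by rewrite gmapZ.
Qed.

Lemma regL_endo (g : ghom (regL S) (regL S)) : exists f, g = rmul f.
Proof.
have [f fE] : exists f, HOM_of f = g (HOM_id M).
  by apply: HOMgr1_ghom; apply: (ghom_deg g); apply: HOMgr_id.
exists f; apply: ghomP => s; rewrite /= fE.
have {1}-> : s = (s : S) *: (HOM_id M : regL S) by apply: HOMP.
by rewrite gmapZ.
Qed.

Lemma HOM_eval0 (s : HOM M M) (x : M) : s = 0 -> s x = 0.
Proof. by move=> ->. Qed.

Definition gsub_into W : gsub (regR S).
Proof.
refine (@GSub _ _ _ _ (regR S) (fun s : HOM M M => forall m, W (s m)) _ _ _ _).
- by move=> m; apply: gsub0.
- by move=> s t sW tW m; rewrite (homBE (s : HOM M M)); apply: gsubB.
- by move=> k s sW m; apply: sW.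
(* It suffices to evaluate at homogeneous elements, where a component of [s] gives a component of
   the value of [s]. *)
- move=> s a sW m; rewrite -[m](gcomp_sum (mgrP M)) hom_sum.
  apply: gsub_sum => b _; rewrite (HOM_gcomp_map _ _ (gcomp_gr _ _ _)).
  exact: gsubC.
Defined.

Definition gsub_ann W : gsub (regL S).
Proof.
refine (@GSub _ _ _ _ (regL S) (fun s : HOM M M => forall m, W m -> s m = 0)
  _ _ _ _).
- by [].
- by move=> s t sW tW m Wm; rewrite (homBE (s : HOM M M)) sW ?tW ?subrr.
- by move=> k s sW m Wm; rewrite -[LHS]/((k : HOM M M) (s m)) sW ?hom0.
- move=> s a sW m Wm; rewrite -[m](gcomp_sum (mgrP M)) hom_sum.
  apply: big1 => b _; rewrite (HOM_gcomp_map _ _ (gcomp_gr _ _ _)).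
  by rewrite sW ?gcomp0 //; apply: gsubC.
Defined.

Definition gsub_perp (Y : gsub (regL S)) : gsub M.
Proof.
refine (@GSub _ _ _ _ M (fun m => forall s : HOM M M, Y s -> s m = 0) _ _ _ _).
- by move=> s _; apply: hom0.
- by move=> x y xY yY s Ys; rewrite homB xY ?yY ?subrr.
- by move=> k x xY s Ys; rewrite homZ xY ?scaler0.
(* Here [s] is decomposed instead: its components stay in [Y] and carry components of [x] to
   components of values. *)
- move=> x b xY s Ys; rewrite -[s](gcomp_sum (HOMgrP M M)) hom_sumE.
  apply: big1 => a _; rewrite (HOM_map_gcomp _ _ (gcomp_gr (HOMgrP M M) s a)).
  by rewrite xY ?gcomp0 //; apply: (gsubC a Ys).
Defined.

End Endomorphisms.

(** * The evaluation map from a tensor product to M *)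

Section TensorEvaluation.
Variables (G : groupType) (R : gradedRing G) (M : grRight R).
Local Notation S := (END M).

Lemma gr_sum (I : choiceType) (V : zmodType) (g : I -> set V) i (J : eqType)
    (s : seq J) (F : J -> V) : is_grading g ->
  (forall j, j \in s -> g i (F j)) -> g i (\sum_(j <- s) F j).
Proof.
move=> gP gF; rewrite big_seq; elim/big_ind: _ => //; first exact: gr0 gP i.
move=> x y gx gy; rewrite -[y]opprK -[- y]sub0r.
by apply: (grB gP) => //; apply: (grB gP) => //; apply: gr0 gP i.
Qed.

Section Eval.
Variables (N : grRight S) (j : ghom N (regR S)).

(** When [j] is the inclusion of a right ideal Y, this is the multiplication map from Y (x) M onto Y
    M. *)
Definition tev_fun : tensor N -> M := tlift (fun n m => (j n : HOM M M) m).

Lemma tev_sum (s : seq (N * M)) :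
  tev_fun (\sum_(p <- s) tmk p.1 p.2) = \sum_(p <- s) (j p.1 : HOM M M) p.2.
Proof.
rewrite -tpi_sum; apply: tlift_pi => [n n' m|n m m'|n k m].
- by rewrite gmapD; apply: homDE.
- exact: homD.
- by rewrite gmapZ.
Qed.

Lemma tev_linear : linear (tev_fun : tensor_gmod N -> M).
Proof.
move=> r t u; have [[s ->] [s' ->]] := (tensorP t, tensorP u).
rewrite scaler_sumr (eq_bigr (fun p => tmk p.1 (r *: p.2))); last first.
  by move=> p _; apply: tensZ.
rewrite -(big_map (fun p => (p.1, r *: p.2)) xpredT (fun p => tmk p.1 p.2)).
rewrite -big_cat !tev_sum big_cat big_map; congr (_ + _) => /=.
by rewrite scaler_sumr; apply: eq_bigr => p _; rewrite homZ.
Qed.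

Lemma tev_deg c (t : tensor_gmod N) : mgr c t -> mgr c (tev_fun t).
Proof.
move=> [s hs ->]; rewrite tev_sum; apply: gr_sum (mgrP M) _ => p /hs.
by move=> [a [b [<- ha hb]]]; apply: (ghom_deg j ha).
Qed.

Definition tev : ghom (tensor_gmod N) M := GHom tev_linear tev_deg.

Lemma tev_mk n m : tev (tmk n m) = (j n : HOM M M) m.
Proof. by have := tev_sum [:: (n, m)]; rewrite !big_seq1. Qed.

(** In S (x) M one has [s (x) m = 1 (x) s m]. This carries information between [tmap j] and
    [tev j]. *)
Lemma tmap_tev t : tmap j t = tmk (HOM_id M : regR S) (tev t).
Proof.
have [s ->] := tensorP t; rewrite tmap_sum [tev _]tev_sum.
rewrite (big_morph (tmk _) (tmkDr _) (tmk0r _)); apply: eq_bigr => p _.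
by rewrite -tmk_bal; congr tmk; apply: HOMP.
Qed.

End Eval.

Lemma tev_lmul N (j : ghom N (regR S)) (f : ghom M M) t :
  tev (ghom_comp (lmul f) j) t = f (tev j t).
Proof.
have [s ->] := tensorP t; rewrite [LHS]tev_sum [tev _ _]tev_sum gmap_sum.
by [].
Qed.

Lemma flat_exact (X Y Z : grRight S) (f : ghom X Y) (g : ghom Y Z) :
  left_flat M -> (forall y, g y = 0 <-> exists x, f x = y) ->
  forall t, tmap g t = 0 <-> exists t', tmap f t' = t.
Proof. by move=> Mflat /exact_atP/Mflat/exact_atP. Qed.

(** Injectivity of [f] is exactness of X -> X -> Y with first map zero, and tensoring keeps that map
    zero. *)
Lemma flat_tmap_inj (X Y : grRight S) (f : ghom X Y) : left_flat M ->
  (forall x, f x = 0 -> x = 0) -> forall t, tmap f t = 0 -> t = 0.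
Proof.
move=> Mflat f0 t.
have fE x : f x = 0 <-> exists y, ghom_zero X X y = x.
  by split=> [/f0 x0|[y <-]]; [exists 0; rewrite x0|exact: ghom0].
move=> /(flat_exact Mflat fE)[t' <-].
have [s ->] := tensorP t'; rewrite tmap_sum; apply: big1 => p _; exact: tmk0l.
Qed.

End TensorEvaluation.

(** * Flat M: the self-CS-Rickart property of M and of S as a right module *)

Section FlatModule.
Variables (G : groupType) (R : gradedRing G) (M : grRight R).
Local Notation S := (END M).
Hypothesis Mflat : left_flat M.

Lemma END_self_CS_Rickart :
  self_CS_Rickart (C := gr R) M -> self_CS_Rickart (C := gr S) (regR S).
Proof.
move=> /self_CS_RickartP MCS; apply/self_CS_RickartP => g.
have [f ->] := regR_endo g; have [e [eK fe Wess]] := MCS f.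
exists (lmul e); split.
- by move=> s; apply: HOMP => m; apply: eK.
- by move=> s fs; apply: HOMP => m; apply: fe; exact: (HOM_eval0 m fs).
move=> Y Ye Yf; pose j := sub_incl Y.
have YM0 t : tev j t = 0.
  (* The test submodule is Y M, the image of [tev j]. *)
  apply: (Wess (gimage (tev j) (gsub_full _))); last by exists t.
    move=> _ [u _ <-]; have [s ->] := tensorP u.
    rewrite [tev _ _]tev_sum gmap_sum; apply: eq_bigr => p _.
    exact: (congr1 (fun s : HOM M M => s p.2) (Ye _ (sub_inclP p.1))).
  (* Already [u] vanishes: left multiplication by [f] is injective on Y, hence so is its tensor
     product with M, which sends [u] to [1 (x) f (tev j u) = 0]. *)
  move=> _ [u _ <-] fu; rewrite (_ : u = 0) ?ghom0 //.
  apply: (@flat_tmap_inj _ _ _ _ _ (ghom_comp (lmul f) j) Mflat).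
    move=> y fy; apply: (sub_incl_inj (W := Y)); rewrite ghom0.
    by apply: Yf fy; apply: sub_inclP.
  by rewrite tmap_tev tev_lmul fu tmk0r.
move=> s Ys; have [y <-] := sub_incl_surj Ys; apply: HOMP => m.
by rewrite -[LHS](tev_mk j) YM0.
Qed.

(** Exactness of X -> X -> X with both maps zero means X = 0, and it is reflected by the functor. *)
Lemma faithful_HOM_from0 (X : grRight R) : faithfully_projective M ->
  (forall s : HOM M X, s = 0) -> forall x : X, x = 0.
Proof.
pose F0 := fmap (HOM_from M) (ghom_zero X X).
move=> MF H0; have /MF/exact_atP x0 : exact_at F0 F0.
  apply/exact_atP => s; rewrite [s]H0; split=> _; last exact: ghom0.
  by exists 0; apply: ghom0.
by move=> x; have [y <-] := (x0 x).1 erefl.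
Qed.

Lemma self_CS_Rickart_END : faithfully_projective M ->
  self_CS_Rickart (C := gr S) (regR S) -> self_CS_Rickart (C := gr R) M.
Proof.
move=> MF /self_CS_RickartP SCS; apply/self_CS_RickartP => f.
have [e'] := SCS (lmul f); have [e ->] := regR_endo e'; move=> [eK fe Yess].
pose i := sub_incl (gker (lmul f)).
have gi s : lmul f s = 0 <-> exists y, i y = s.
  by split=> [fs|[y <-]]; [exact: sub_incl_surj|exact: (sub_inclP y)].
exists e; split.
- move=> x; exact: (congr1 (fun s : HOM M M => s x) (eK (HOM_id M))).
- move=> x fx.
  (* Since [f (x) x = 1 (x) f x = 0], flatness lifts [1 (x) x] to ann(f) (x) M. Thus [x] is a sum of
     elements [s m] with [f s = 0], and [e] fixes each of them. *)
  have [|t tE] := (flat_exact Mflat gi (tmk (HOM_id M : regR S) x)).1.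
    rewrite tmap_mk (_ : lmul f _ = (HOM_of f : S^c) *: (HOM_id M : regR S)).
      by rewrite tmk_bal /= fx tmk0r.
    exact: HOMP.
  have <- : tev i t = x.
    transitivity (tev (ghom_id (regR S)) (tmk (HOM_id M : regR S) x)).
      rewrite -tE; have [s ->] := tensorP t; rewrite tmap_sum [LHS]tev_sum.
      rewrite [RHS]gmap_sum; apply: eq_bigr => p _.
      by rewrite (tev_mk (ghom_id (regR S))).
    exact: (tev_mk (ghom_id (regR S))).
  have [s ->] := tensorP t; rewrite [tev _ _]tev_sum gmap_sum.
  apply: eq_bigr => p _.
  exact: (congr1 (fun s : HOM M M => s p.2) (fe _ (sub_inclP p.1))).
move=> W We Wf.
have into0 : forall s, gsub_into W s -> s = 0.
  apply: Yess => s sW; first by apply: HOMP => m; apply: We.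
  by move=> fs; apply: HOMP => m; apply: Wf => //; apply: (HOM_eval0 m fs).
move=> x Wx; have [w <-] := sub_incl_surj Wx.
suff -> : w = 0 by apply: ghom0.
(* A map from M to W followed by the inclusion lies in [gsub_into W], so it is zero. *)
apply: (faithful_HOM_from0 MF) => s.
apply: HOMP => m; apply: (sub_incl_inj (W := W)).
rewrite ghom0; apply: (HOM_eval0 (s := HOM_comp (HOM_of (sub_incl W)) s)).
by apply: into0 => m'; apply: sub_inclP.
Qed.

End FlatModule.

(** * Projective M: the dual self-CS-Rickart property of M and of S as a right module *)

Section ProjectiveModule.
Variables (G : groupType) (R : gradedRing G) (M : grRight R).
Local Notation S := (END M).
Hypothesis Mproj : projective_object (C := gr R) M.

(** Corestricting both maps to the image of [p] reduces this to lifting along an epimorphism. *)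
Lemma projective_lift (A B : grRight R) (p : ghom A B) (f : ghom M B) :
  (forall x, exists y, p y = f x) ->
  exists g : ghom M A, forall x, p (g x) = f x.
Proof.
move=> fp; pose W := gimage p (gsub_full A).
have [p' p'E] : exists p' : ghom A (sub_gmod W),
    forall x, sub_incl W (p' x) = p x.
  apply: ghom_factor_inj; first exact: sub_incl_inj.
  by move=> x; apply: sub_incl_surj; exists x.
have [f' f'E] : exists f' : ghom M (sub_gmod W),
    forall x, sub_incl W (f' x) = f x.
  apply: ghom_factor_inj; first exact: sub_incl_inj.
  by move=> x; apply: sub_incl_surj; have [y yE] := fp x; exists y.
have [|g gE] := Mproj (g := p') f'.
  apply/gepi_surjective => w; have [y _ yE] := sub_inclP w.
  by exists y; apply: (sub_incl_inj (W := W)); rewrite p'E.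
by exists g => x; rewrite -p'E -f'E -gE.
Qed.

Lemma dual_self_CS_Rickart_END :
  dual_self_CS_Rickart (C := gr S) (regR S) ->
  dual_self_CS_Rickart (C := gr R) M.
Proof.
move=> /dual_self_CS_RickartP SCS; apply/dual_self_CS_RickartP => f.
have [e'] := SCS (lmul f); have [e ->] := regR_endo e'; move=> [eK fe Ysup].
have eKx x : e (e x) = e x.
  exact: (congr1 (fun s : HOM M M => s x) (eK (HOM_id M))).
exists e; split=> // [x ex|W We Wf].
  (* As [e (1 - e) = 0], the element [1 - e] of S has the form [f s]; it fixes every [x] in ker
     [e]. *)
  have [|s sE] := fe (HOM_of (ghom_sub (ghom_id M) e)).
    by apply: HOMP => m /=; rewrite gmapB eKx subrr.
  exists ((s : HOM M M) x).
  by have := congr1 (fun s : HOM M M => s x) sE; rewrite /= ex subr0.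
pose pi := quot_proj W.
(* Because W + im [f] = M, [pi f] is onto M/W; the lift [s1] satisfies [f s1 = 1] modulo W. *)
have [|s1 s1E] := @projective_lift _ _ (ghom_comp pi f) pi.
  move=> x; have [w Ww [y ->]] := Wf x; exists y => /=.
  apply/esym/subr0_eq; rewrite -[LHS](gmapB pi) addrK.
  exact/quot_proj0.
have W1 x : W (x - f (s1 x)).
  by apply/quot_proj0; rewrite gmapB -s1E subrr.
have YT : forall s, gsub_into W s.
  apply: Ysup => s; first by move=> es m; apply: We; apply: (HOM_eval0 m es).
  (* Decompose [s = (1 - f s1) s + f (s1 s)]; the first term maps M into W. *)
  pose d := ghom_sub (ghom_id M) (ghom_comp f s1).
  exists ((s : S^c) *: (HOM_of d : regR S)).
    by move=> m; apply: W1.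
  exists (HOM_comp (HOM_of s1) s); apply: HOMP => m.
  by rewrite [RHS](homDE (_ : HOM M M)) /= subrK.
by move=> x; apply: (YT (HOM_id M)).
Qed.

(** Surjectivity of [f] is exactness of X -> Y -> Y with second map zero, which faithful flatness
    reflects. *)
Lemma faithful_tmap_surj (X Y : grRight S) (f : ghom X Y) :
  left_faithfully_flat M ->
  (forall t, exists t', tmap (M := M) f t' = t) -> forall y, exists x, f x = y.
Proof.
move=> MF fs; have /MF/exact_atP f0 : exact_at (fmap (tensor_functor M) f)
    (fmap (tensor_functor M) (ghom_zero Y Y)).
  apply/exact_atP => t; split=> _; first exact: fs.
  have [s ->] := tensorP t; rewrite [LHS]tmap_sum.
  by apply: big1 => p _; apply: tmk0l.
by move=> y; apply/f0.
Qed.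

Lemma END_dual_self_CS_Rickart : left_faithfully_flat M ->
  dual_self_CS_Rickart (C := gr R) M ->
  dual_self_CS_Rickart (C := gr S) (regR S).
Proof.
move=> MF /dual_self_CS_RickartP MCS; apply/dual_self_CS_RickartP => g.
have [f ->] := regR_endo g; have [e [eK fe Wsup]] := MCS f.
pose c := ghom_sub (ghom_id M) e.
have ec x : e (c x) = 0 by rewrite /= gmapB eK subrr.
exists (lmul e); split.
- by move=> s; apply: HOMP => m; apply: eK.
(* The map [1 - e] has values in ker [e], hence in im [f], and lifts to [s1] with [f s1 = 1 - e];
   then [e s = 0] gives [s = f (s1 s)]. *)
- move=> s es; have [|s1 s1E] := @projective_lift _ _ f c.
    by move=> x; apply: fe.
  exists (HOM_comp (HOM_of s1) s); apply: HOMP => m.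
  rewrite -[LHS]/(f (s1 ((s : HOM M M) m))) s1E /=.
  by rewrite [e _](HOM_eval0 m es) subr0.
move=> Y Ye Yf; pose j := sub_incl Y.
have YMT : forall x, exists t, tev j t = x.
  suff YMW x : gimage (tev j) (gsub_full _) x.
    by move=> x; have [t _] := YMW x; exists t.
  (* Y M contains ker [e] because [1 - e] is in Y, and writing the identity as an element of Y plus
     [f s'] gives Y M + im [f] = M. *)
  apply: Wsup => {}x.
    move=> ex; have Yc : Y (HOM_of c) by apply: Ye; apply: HOMP => m; apply: ec.
    have [y yE] := sub_incl_surj Yc.
    by exists (tmk y x) => //; rewrite tev_mk yE /= ex subr0.
  have [s Ys [s' E]] := Yf (HOM_id M); have [y yE] := sub_incl_surj Ys.
  exists (tev j (tmk y x)); first by exists (tmk y x).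
  exists ((s' : HOM M M) x); rewrite tev_mk yE.
  have := congr1 (fun s : HOM M M => s x) E.
  by rewrite (homDE (s : HOM M M)).
have js := @faithful_tmap_surj _ _ j MF _.
move=> s; have [|y <-] := js _ s; last exact: sub_inclP.
(* Every [t] in S (x) M equals [1 (x) m] with [m] its evaluation, so a [t'] with the same evaluation
   is sent to [t]. *)
move=> t; have [t' t'E] := YMT (tev (ghom_id (regR S)) t).
exists t'; rewrite tmap_tev t'E -tmap_tev.
by have [u ->] := tensorP t; rewrite tmap_sum.
Qed.

End ProjectiveModule.

(** * Degree shifts of graded left modules *)

Section Shift.
Variables (G : groupType) (K : pzRingType) (kgr : G -> set K).
Local Notation gleft := (gmod kgr (fun a b => (a * b)%g)).
Variables (X : gleft) (c : G).

(** Scalars multiply degrees on the left, so the shift is on the right. It turns maps of arbitrary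
    degree into degree-preserving ones. *)
Definition shift_gr (a : G) : set X := mgr (a * c)%g.

Lemma shift_grP : is_grading shift_gr.
Proof.
split.
- by move=> a; apply: gr0 (mgrP X) _.
- by move=> a; apply: (grB (mgrP X)).
- move=> x; exists [seq a * c^-1 | a <- gsupp (mgrP X) x]%g,
    (fun a => gcomp (mgrP X) x (a * c)%g); split.
  + by rewrite map_inj_uniq ?gsupp_uniq //; apply: mulIg.
  + by move=> a; apply: gcomp_gr.
  + rewrite big_map -{1}[x](gcomp_sum (mgrP X)).
    by apply: eq_bigr => a _; rewrite mulgVK.
- move=> s F us Fgr F0 a sa.
  have := @gr_direct _ _ _ (mgrP X) [seq b * c | b <- s]%g
    (fun b => F (b * c^-1)%g) _ _ _ (a * c)%g.
  rewrite mulgK; apply.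
  + by rewrite map_inj_uniq //; apply: mulIg.
  + by move=> b; rewrite -{1}[b](mulgVK c); apply: Fgr.
  + by rewrite big_map -[RHS]F0; apply: eq_bigr => b _; rewrite mulgK.
  + exact: map_f.
Qed.

Lemma shift_grZ a b (k : K) (x : X) :
  kgr a k -> shift_gr b x -> shift_gr (a * b)%g (k *: x).
Proof. by move=> ka xb; rewrite /shift_gr -mulgA; apply: mgrZ. Qed.

Definition shift_gmod : gleft := GMod shift_grP shift_grZ.

End Shift.

(** * Injective M over S: dual self-CS-Rickart M and self-CS-Rickart S as a left module *)

Section InjectiveModule.
Variables (G : groupType) (R : gradedRing G) (M : grRight R).
Local Notation S := (END M).
Hypothesis Minj : injective_object (C := grop S) (Mleft M).

(* The map [s f |-> s x] from [Y f] to [M] has degree [b]; after shifting it  *)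
(* extends to [S], and [m] is the image of the identity.                      *)
Lemma injective_annihilator (Y : gsub (regL S)) (f : ghom M M) b (x : M) :
  mgr b x -> (forall s : HOM M M, Y s -> rmul f s = 0 -> s x = 0) ->
  exists m, forall s : HOM M M, Y s -> s x = s (f m).
Proof.
move=> xb fx; pose T := shift_gmod (regL S) b^-1%g.
pose A := shift_gmod (sub_gmod Y) b^-1%g.
have gd a (s : A) : mgr a s -> mgr a (rmul f (sub_incl Y s) : T).
  by move=> sa; apply: (ghom_deg (rmul f)); apply: (ghom_deg (sub_incl Y)).
have gl : linear (fun s : A => rmul f (sub_incl Y s) : T).
  by move=> k s t; rewrite -[RHS](ghom_linear (rmul f)).
have hd a (s : A) : mgr a s -> mgr a ((sub_incl Y s : HOM M M) x : Mleft M).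
  move=> sa; rewrite -[a](mulgVK b).
  exact: (sa : HOMgr _ (sub_incl Y s : HOM M M)).
have hl : linear (fun s : A => (sub_incl Y s : HOM M M) x : Mleft M).
  by move=> k s t; rewrite -[RHS](homDE (HOM_comp k _) _).
pose g : ghom A T := GHom gl gd; pose h : ghom A (Mleft M) := GHom hl hd.
pose W := gimage g (gsub_full A).
have [p pE] : exists p : ghom A (sub_gmod W), forall s, sub_incl W (p s) = g s.
  apply: ghom_factor_inj; first exact: sub_incl_inj.
  by move=> s; apply: sub_incl_surj; exists s.
have ps w : exists s, p s = w.
  have [s _ sE] := sub_inclP w.
  by exists s; apply: (sub_incl_inj (W := W)); rewrite pE.
(* The hypothesis [fx] says that ker [g] is contained in ker [h], so [h] descends to Y [f]. *)
have [|q qE] := ghom_factor_surj (f := h) ps.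
  move=> s p0; apply: fx; first exact: sub_inclP.
  by rewrite -[LHS]/(g s) -pE p0 ghom0.
have [|phi /ghom_eqP phiE] := Minj (g := sub_incl W) q.
  by apply/gmono_injective; apply: sub_incl_inj.
exists (phi (HOM_id M)) => s Ys; have [y yE] := sub_incl_surj Ys.
rewrite -[in LHS]yE -[LHS]/(h y) -qE -phiE -[LHS]/(phi (sub_incl W (p y))) pE.
have -> : g y = (HOM_comp s (HOM_of f) : S) *: (HOM_id M : T).
  by rewrite -yE; apply: HOMP.
by rewrite gmapZ.
Qed.

Lemma END_left_self_CS_Rickart : dual_self_CS_Rickart (C := gr R) M ->
  self_CS_Rickart (C := grop S) (regL S).
Proof.
move=> /dual_self_CS_RickartP MCS; apply/self_CS_RickartP => g.
have [f ->] := regL_endo g; have [e [eK fe Wsup]] := MCS f.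
exists (rmul e); split.
- by move=> s; apply: HOMP => m; rewrite /= eK.
(* The element [e m - m] is in ker [e], hence in im [f], which [s] kills. *)
- move=> s fs; apply: HOMP => m /=; apply/subr0_eq; rewrite -homB.
  have [|y <-] := fe (e m - m); first by rewrite gmapB eK subrr.
  exact: (HOM_eval0 y fs).
move=> Y Ye Yf.
(* The test submodule is Y^perp: it contains ker [e] since [s = s e] on Y, and once it is all of M,
   every [s] in Y is zero. *)
have perpT : forall x, gsub_perp Y x.
  apply: Wsup => x.
    by move=> ex s Ys; rewrite -(Ye s Ys) /= ex hom0.
  (* Only homogeneous elements can be handled by the shift, so [x] is treated component by
     component. *)
  have xE a : exists m, gsub_perp Y (gcomp (mgrP M) x a - f m).
    have [|m mE] := injective_annihilator (gcomp_gr (mgrP M) x a)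
                      (Y := Y) (f := f).
      by move=> s Ys fs; rewrite (Yf s Ys fs).
    by exists m => s Ys; rewrite homB mE ?subrr.
  have [m mE] := choice xE.
  exists (\sum_(a <- gsupp (mgrP M) x) (gcomp (mgrP M) x a - f (m a))).
    by apply: gsub_sum => a _; apply: mE.
  exists (\sum_(a <- gsupp (mgrP M) x) m a).
  by rewrite gmap_sum sumrB subrK gcomp_sum.
by move=> s Ys; apply: HOMP => m; apply: perpT.
Qed.

(** As for [faithful_HOM_from0], exactness at X between zero maps is reflected. *)
Lemma faithful_HOM_into0 (X : grRight R) : faithfully_injective M ->
  (forall s : HOM X M, s = 0) -> forall x : X, x = 0.
Proof.
pose F0 := cfmap (HOM_into M) (ghom_zero X X).
move=> MF H0; have /MF/exact_atP x0 : exact_at F0 F0.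
  apply/exact_atP => s; rewrite [s]H0; split=> _; last exact: ghom0.
  by exists 0; apply: ghom0.
by move=> x; have [y <-] := (x0 x).1 erefl.
Qed.

Lemma left_self_CS_Rickart_END : faithfully_injective M ->
  self_CS_Rickart (C := grop S) (regL S) ->
  dual_self_CS_Rickart (C := gr R) M.
Proof.
move=> MF /self_CS_RickartP SCS; apply/dual_self_CS_RickartP => f.
have [e'] := SCS (rmul f); have [e ->] := regL_endo e'; move=> [eK fe Yess].
exists e; split.
- move=> x; exact: (congr1 (fun s : HOM M M => s x) (eK (HOM_id M))).
- move=> x ex.
  (* Apply the extension lemma to Y = S: if [s f = 0] then [s = s e], which kills the components of
     [x]. The choice [s = 1] gives the preimage. *)
  have xE a : exists m, f m = gcomp (mgrP M) x a.
    have [|m mE] := injective_annihilator (gcomp_gr (mgrP M) x a)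
                      (Y := gsub_full (regL S)) (f := f).
      move=> s _ /fe se.
      rewrite -se -[LHS]/((s : HOM M M) (e _)) gmap_comp ex gcomp0.
      exact: hom0.
    by exists m; apply/esym; apply: (mE (HOM_id M)).
  have [m mE] := choice xE; exists (\sum_(a <- gsupp (mgrP M) x) m a).
  rewrite gmap_sum -[RHS](gcomp_sum (mgrP M)).
  by apply: eq_bigr => a _; apply: mE.
move=> W We Wf.
have ann0 : forall s, gsub_ann W s -> s = 0.
  (* If [s] kills W, it kills ker [e], so [s e = s]; if also [s f = 0], then [s] kills W + im [f] =
     M. *)
  apply: Yess => s sW.
    apply: HOMP => m; apply/subr0_eq; rewrite -[LHS](homB (s : HOM M M)).
    apply: sW; apply: We; rewrite gmapB.
    have -> : e (e m) = e m.
      exact: (congr1 (fun s : HOM M M => s m) (eK (HOM_id M))).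
    by rewrite subrr.
  move=> fs; apply: HOMP => m; have [w Ww [y ->]] := Wf m.
  by rewrite homD sW // add0r; apply: (HOM_eval0 y fs).
(* A map from M/W to M composed with the projection kills W, so it is zero; faithful injectivity
   then gives M/W = 0. *)
move=> x; apply/quot_proj0; apply: (faithful_HOM_into0 MF) => s.
apply: HOMP => u; have [m <-] := quot_proj_surj u.
apply: (HOM_eval0 (s := HOM_comp s (HOM_of (quot_proj W)))).
apply: ann0 => w Ww; rewrite -[LHS]/(s (quot_proj W w)).
by rewrite (quot_proj0 W w).2 // hom0.
Qed.

End InjectiveModule.

Theorem corollary5p5 (G : groupType) (R : gradedRing G) (M : grRight R) :
  (left_flat M ->
     (self_CS_Rickart (C := gr R) M ->
        self_CS_Rickart (C := gr (END M)) (regR (END M))) /\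
     (faithfully_projective M ->
        self_CS_Rickart (C := gr (END M)) (regR (END M)) ->
        self_CS_Rickart (C := gr R) M)) /\
  (projective_object (C := gr R) M ->
     (dual_self_CS_Rickart (C := gr (END M)) (regR (END M)) ->
        dual_self_CS_Rickart (C := gr R) M) /\
     (left_faithfully_flat M ->
        dual_self_CS_Rickart (C := gr R) M ->
        dual_self_CS_Rickart (C := gr (END M)) (regR (END M)))) /\
  (injective_object (C := grop (END M)) (Mleft M) ->
     (dual_self_CS_Rickart (C := gr R) M ->
        self_CS_Rickart (C := grop (END M)) (regL (END M))) /\
     (faithfully_injective M ->
        self_CS_Rickart (C := grop (END M)) (regL (END M)) ->
        dual_self_CS_Rickart (C := gr R) M)).
Proof.
split=> [Mflat|]; first by split=> [|MF];
  [exact: END_self_CS_Rickart|exact: self_CS_Rickart_END].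
split=> Mobj; split=> [|MF].
- exact: dual_self_CS_Rickart_END.
- exact: END_dual_self_CS_Rickart.
- exact: END_left_self_CS_Rickart.
- exact: left_self_CS_Rickart_END.
Qed.
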